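(* Let $(S,\mathcal{A},\mu)$ be a complete measure space, let $E$ be a Köthe function space over $(S,\mathcal{A},\mu)$ and let $X$ be a Banach space. If the measure $\mu$ is finite and $E$ is LUR, then $E(X)$ is a $\mathrm{luacs}^+$ space whenever $X$ is $\mathrm{luacs}^+$. If in addition the Köthe dual $E'$ is order continuous, then the assertion also holds if $\mu$ is merely $\sigma$-finite (that is: if $\mu$ is $\sigma$-finite, $E$ is LUR and $E'$ is order continuous, then $E(X)$ is $\mathrm{luacs}^+$ whenever $X$ is $\mathrm{luacs}^+$).
   Context: All Banach spaces are real. For a Banach space $X$, $X^*$ denotes its dual, $B_X$ its closed unit ball and $S_X$ its unit sphere. A Banach space $X$ is called: - LUR (locally uniformly rotund) if for every $x\in S_X$ and every sequence $(x_n)$ in $S_X$, $\|x_n+x\|\to2$ implies $\|x_n-x\|\to0$; - $\mathrm{luacs}^+$ if for every $x\in S_X$, every sequence $(x_n)$ in $S_X$ with $\|x_n+x\|\to2$ and all $x^*\in S_{X^*}$: $x^*(x_n)\to1$ if and only if $x^*(x)=1$. A Köthe function space over a complete, $\sigma$-finite measure space $(S,\mathcal{A},\mu)$ is a Banach space $(E,\|\cdot\|_E)$ of real-valued measurable functions on $S$ modulo equality $\mu$-a.e. such that: (i) $\chi_A\in E$ for every $A\in\mathcal{A}$ with $\mu(A)<\infty$; (ii) every $f\in E$ is $\mu$-integrable over every $A\in\mathcal{A}$ with $\mu(A)<\infty$; (iii) if $g$ is measurable and $f\in E$ with $|g(t)|\le|f(t)|$ $\mu$-a.e., then $g\in E$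 and $\|g\|_E\le\|f\|_E$. With the order $f\le g$ iff $f(t)\le g(t)$ $\mu$-a.e., $E$ is a Banach lattice; a Köthe function space is order continuous if every decreasing net in it with infimum zero is norm-convergent to zero. The Köthe dual $E'$ is the space of all measurable $g:S\to\mathbb{R}$ (modulo equality a.e.) with $\|g\|_{E'}:=\sup\{\int_S|fg|\,\mathrm{d}\mu:f\in B_E\}<\infty$; it is again a Köthe function space. For a Köthe function space $E$ and a Banach space $X$, the Köthe-Bochner space $E(X)$ is the Banach space of all Bochner-measurable functions $f:S\to X$ (modulo equality a.e.) with $\|f(\cdot)\|\in E$, normed by $\|f\|_{E(X)}=\|\,\|f(\cdot)\|\,\|_E$; Bochner-measurable means being the $\mu$-a.e. norm limit of a sequence of simple functions. *)

(* Defs.v *)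
From HB Require Import structures.
From mathcomp Require Import all_boot all_order all_algebra.
From mathcomp Require Import all_classical all_reals all_analysis.
From mathcomp Require Import measurable_realfun.

Set Implicit Arguments.
Unset Strict Implicit.
Unset Printing Implicit Defensive.

Import Order.TTheory GRing.Theory Num.Theory.
Import numFieldNormedType.Exports.

Local Open Scope classical_set_scope.
Local Open Scope ring_scope.

Section rotundity.
Context (R : realType) (V : normedModType R).

(* LUR and luacs+ are notions for Banach spaces; their definitions only use the
   normed space structure. *)
Definition LUR := forall (x : V) (u : nat -> V),
  `|x| = 1 -> (forall n, `|u n| = 1) ->
  (fun n => `|u n + x|) @ \oo --> (2 : R) ->
  (fun n => `|u n - x|) @ \oo --> (0 : R).

Definition dual_norm (phi : {linear V -> R^o}) : R :=
  sup [set `|phi x| | x in [set x : V | `|x| <= 1]].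

Definition dual_sphere (phi : {linear V -> R^o}) :=
  continuous (phi : V -> R^o) /\ dual_norm phi = 1.

Definition luacs_plus := forall (x : V) (u : nat -> V),
  `|x| = 1 -> (forall n, `|u n| = 1) ->
  (fun n => `|u n + x|) @ \oo --> (2 : R) ->
  forall phi : {linear V -> R^o}, dual_sphere phi ->
    ((fun n => phi (u n) : R) @ \oo --> (1 : R)) <-> phi x = 1.

End rotundity.

Section normed_function_space.
Context d (S : measurableType d) (R : realType).
Context (mu : {measure set S -> \bar R}) (X : normedModType R).

(* A vector space of functions S -> X with a seminorm whose kernel is exactly
   the set of a.e. null functions; the associated normed space of classes
   modulo a.e. equality is [ae_class] below. Nothing is required of
   [nfs_norm f] when f is not in the carrier. *)
Record normed_fun_space := NormedFunSpace {
  nfs_carrier :> (S -> X) -> Prop;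
  nfs_norm : (S -> X) -> R;
  nfs_mem0 : nfs_carrier (fun=> 0);
  nfs_memD : forall f g, nfs_carrier f -> nfs_carrier g ->
    nfs_carrier (fun t => f t + g t);
  nfs_memZ : forall (a : R) f, nfs_carrier f ->
    nfs_carrier (fun t => a *: f t);
  nfs_normD : forall f g, nfs_carrier f -> nfs_carrier g ->
    nfs_norm (fun t => f t + g t) <= nfs_norm f + nfs_norm g;
  nfs_normZ : forall (a : R) f, nfs_carrier f ->
    nfs_norm (fun t => a *: f t) = `|a| * nfs_norm f;
  nfs_norm_eq0 : forall f, nfs_carrier f ->
    nfs_norm f = 0 <-> {ae mu, forall t, f t = 0}
}.

End normed_function_space.

Section ae_class.
Context d (S : measurableType d) (R : realType).
Context (mu : {measure set S -> \bar R}) (X : normedModType R).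
Variable F : normed_fun_space mu X.

Definition nfs_elt := {f : S -> X | F f}.
HB.instance Definition _ := gen_eqMixin nfs_elt.
HB.instance Definition _ := gen_choiceMixin nfs_elt.

Definition ae_eqb (f g : nfs_elt) : bool :=
  `[< {ae mu, forall t, sval f t = sval g t} >].

Let ae_eqb_refl : reflexive ae_eqb.
Proof. by move=> f; apply/asboolP/aeW. Qed.

Let ae_eqb_sym : symmetric ae_eqb.
Proof.
by move=> f g; apply/idP/idP => /asboolP h; apply/asboolP;
  apply: filterS h => t ->.
Qed.

Let ae_eqb_trans : transitive ae_eqb.
Proof.
move=> f g h /asboolP gf /asboolP fh; apply/asboolP.
by move: gf fh; apply: filterS2 => t -> ->.
Qed.

Canonical ae_eqb_equiv := EquivRel ae_eqb ae_eqb_refl ae_eqb_sym ae_eqb_trans.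

Local Open Scope quotient_scope.

Definition ae_class : Type := {eq_quot ae_eqb}.
HB.instance Definition _ := Choice.on ae_class.
HB.instance Definition _ := EqQuotient.on ae_class.

Definition ae_class_of (f : S -> X) (Ff : F f) : ae_class :=
  \pi_ae_class (exist _ f Ff).

Definition ae_repr (u : ae_class) : S -> X := sval (repr u).


Lemma ae_reprP (u : ae_class) : F (ae_repr u).
Proof. exact: svalP. Qed.

Lemma ae_class_of_eq (f g : S -> X) (Ff : F f) (Fg : F g) :
  ae_class_of Ff = ae_class_of Fg <-> {ae mu, forall t, f t = g t}.
Proof.
rewrite /ae_class_of; split.
  by move=> /eqmodP /asboolP.
by move=> fg; apply/eqmodP/asboolP.
Qed.

Lemma ae_reprK (u : ae_class) : ae_class_of (ae_reprP u) = u.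
Proof.
rewrite -[RHS]reprK /ae_class_of; apply/eqmodP/asboolP; exact: aeW.
Qed.

Lemma ae_repr_of (f : S -> X) (Ff : F f) :
  {ae mu, forall t, ae_repr (ae_class_of Ff) t = f t}.
Proof. by apply/(ae_class_of_eq (ae_reprP _) Ff); rewrite ae_reprK. Qed.

Definition ae_class_zero : ae_class := ae_class_of (nfs_mem0 F).
Definition ae_class_add (u v : ae_class) : ae_class :=
  ae_class_of (nfs_memD (ae_reprP u) (ae_reprP v)).
Definition ae_class_scale (a : R) (u : ae_class) : ae_class :=
  ae_class_of (nfs_memZ a (ae_reprP u)).
Definition ae_class_opp (u : ae_class) : ae_class := ae_class_scale (- 1) u.

Let ae_class_ext (u v : ae_class) :
  {ae mu, forall t, ae_repr u t = ae_repr v t} -> u = v.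
Proof. by move=> uv; rewrite -[LHS]ae_reprK -[RHS]ae_reprK; apply/ae_class_of_eq. Qed.

Let addE (u v : ae_class) :
  {ae mu, forall t, ae_repr (ae_class_add u v) t = ae_repr u t + ae_repr v t}.
Proof. exact: ae_repr_of. Qed.

Let addA : associative ae_class_add.
Proof.
move=> u v w; apply: ae_class_ext.
have h : {ae mu, forall t,
    ae_repr (ae_class_add u v) t = ae_repr u t + ae_repr v t /\
    ae_repr (ae_class_add v w) t = ae_repr v t + ae_repr w t}.
  by move: (addE u v) (addE v w); apply: filterS2.
move: h (addE u (ae_class_add v w)) (addE (ae_class_add u v) w).
apply: filterS3 => t [e2 e1] e3 e4.
by rewrite e3 e4 e1 e2 addrA.
Qed.

Let addC : commutative ae_class_add.
Proof.
by move=> u v; apply/ae_class_of_eq/aeW => t; rewrite addrC.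
Qed.

Let add0 : left_id ae_class_zero ae_class_add.
Proof.
move=> u; apply: ae_class_ext.
have := ae_repr_of (nfs_mem0 F).
have := addE ae_class_zero u.
by apply: filterS2 => t e1 e2; rewrite e1 e2 add0r.
Qed.

Let addN : left_inverse ae_class_zero ae_class_opp ae_class_add.
Proof.
move=> u; apply/ae_class_of_eq.
have := ae_repr_of (nfs_memZ (- 1) (ae_reprP u)).
by apply: filterS => t e; rewrite e scaleN1r addNr.
Qed.

HB.instance Definition _ := GRing.isZmodule.Build ae_class addA addC add0 addN.

Let scaleA (a b : R) (u : ae_class) :
  ae_class_scale a (ae_class_scale b u) = ae_class_scale (a * b) u.
Proof.
apply/ae_class_of_eq; have := ae_repr_of (nfs_memZ b (ae_reprP u)).
by apply: filterS => t e; rewrite e scalerA.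
Qed.

Let scale1 : left_id 1 ae_class_scale.
Proof.
move=> u; apply: ae_class_ext.
have := ae_repr_of (nfs_memZ 1 (ae_reprP u)).
by apply: filterS => t e; rewrite e scale1r.
Qed.

Let scaleDr : right_distributive ae_class_scale +%R.
Proof.
move=> a u v; apply/ae_class_of_eq.
have := ae_repr_of (nfs_memD (ae_reprP u) (ae_reprP v)).
have := ae_repr_of (nfs_memZ a (ae_reprP u)).
have := ae_repr_of (nfs_memZ a (ae_reprP v)).
by apply: filterS3 => t e1 e2 e3; rewrite e1 e2 e3 scalerDr.
Qed.

Let scaleDl (u : ae_class) :
  {morph ae_class_scale^~ u : a b / a + b}.
Proof.
move=> a b; apply/ae_class_of_eq.
have := ae_repr_of (nfs_memZ a (ae_reprP u)).
have := ae_repr_of (nfs_memZ b (ae_reprP u)).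
by apply: filterS2 => t e1 e2; rewrite e1 e2 scalerDl.
Qed.

HB.instance Definition _ := GRing.Zmodule_isLmodule.Build R ae_class
  scaleA scale1 scaleDr scaleDl.

Lemma ae_class_ofD (f g : S -> X) (Ff : F f) (Fg : F g) :
  ae_class_of Ff + ae_class_of Fg = ae_class_of (nfs_memD Ff Fg).
Proof.
apply/ae_class_of_eq; have := ae_repr_of Fg; have := ae_repr_of Ff.
by apply: filterS2 => t -> ->.
Qed.

Lemma ae_class_ofZ (a : R) (f : S -> X) (Ff : F f) :
  a *: ae_class_of Ff = ae_class_of (nfs_memZ a Ff).
Proof.
by apply/ae_class_of_eq; have := ae_repr_of Ff; apply: filterS => t ->.
Qed.

Lemma nfs_norm_ae (f g : S -> X) : F f -> F g ->
  {ae mu, forall t, f t = g t} -> nfs_norm F f = nfs_norm F g.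
Proof.
suff H h k : F h -> F k -> {ae mu, forall t, h t = k t} ->
    nfs_norm F h <= nfs_norm F k.
  move=> Ff Fg fg; apply/eqP; rewrite eq_le !H//.
  by apply: filterS fg => t ->.
move=> Fh Fk hk; pose e t := h t + (- 1) *: k t.
have Fe : F e by apply: nfs_memD => //; exact: nfs_memZ.
have e0 : nfs_norm F e = 0.
  by apply/nfs_norm_eq0 => //; apply: filterS hk => t hkt; rewrite /e hkt scaleN1r subrr.
have -> : h = fun t => e t + k t.
  by apply/funext => t; rewrite /e scaleN1r subrK.
by apply: le_trans (nfs_normD _ _) _ => //; rewrite e0 add0r.
Qed.

Definition ae_class_norm (u : ae_class) : R := nfs_norm F (ae_repr u).

Let normD (u v : ae_class) :
  ae_class_norm (u + v) <= ae_class_norm u + ae_class_norm v.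
Proof.
rewrite /ae_class_norm (nfs_norm_ae (ae_reprP _) _ (ae_repr_of _)).
  exact: nfs_normD (ae_reprP _) (ae_reprP _).
exact: nfs_memD (ae_reprP _) (ae_reprP _).
Qed.

Let normZ (a : R) (u : ae_class) :
  ae_class_norm (a *: u) = `|a| * ae_class_norm u.
Proof.
rewrite /ae_class_norm (nfs_norm_ae (ae_reprP _) _ (ae_repr_of _)).
  exact: nfs_normZ (ae_reprP _).
exact: nfs_memZ (ae_reprP _).
Qed.

Let norm_eq0 (u : ae_class) : ae_class_norm u = 0 -> u = 0.
Proof.
move=> /(nfs_norm_eq0 (ae_reprP u)) u0; rewrite -[LHS]ae_reprK.
exact/ae_class_of_eq.
Qed.

HB.instance Definition _ := Lmodule_isNormed.Build R ae_class
  normD normZ norm_eq0.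

Lemma ae_class_of_norm (f : S -> X) (Ff : F f) :
  `|ae_class_of Ff| = nfs_norm F f.
Proof. exact: nfs_norm_ae (ae_reprP _) Ff (ae_repr_of Ff). Qed.

End ae_class.

Section kothe.
Context d (S : measurableType d) (R : realType).
Context (mu : {measure set S -> \bar R}).

(* [ks_banach]: the space of classes modulo a.e. equality is complete. Since
   membership of measurable functions and norm are a.e. invariant by [ks_ideal],
   [ks_space] amounts to a space of classes of measurable functions. *)
Record kothe_space := KotheSpace {
  ks_space :> normed_fun_space mu R;
  ks_banach : forall G : set_system (ae_class ks_space),
    ProperFilter G -> cauchy G -> cvg G;
  ks_measurable : forall f, ks_space f -> measurable_fun setT f;
  ks_indic : forall A, measurable A -> (mu A < +oo)%E -> ks_space \1_A;
  ks_integrable : forall f A, ks_space f -> measurable A -> (mu A < +oo)%E ->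
    mu.-integrable A (EFin \o f);
  ks_ideal : forall f g : S -> R, ks_space f -> measurable_fun setT g ->
    {ae mu, forall t, `|g t| <= `|f t|} ->
    ks_space g /\ nfs_norm ks_space g <= nfs_norm ks_space f
}.

Section kothe_dual.
Variable E : kothe_space.

(* ||g||_{E'} as an extended real. *)
Definition kothe_dual_enorm (g : S -> R) : \bar R :=
  ereal_sup [set (\int[mu]_t `|f t * g t|%:E)%E |
             f in [set f | E f /\ nfs_norm E f <= 1]].

Definition kothe_dual : set (S -> R) :=
  [set g | measurable_fun setT g /\ (kothe_dual_enorm g < +oo)%E].

Definition kothe_dual_norm (g : S -> R) : R := fine (kothe_dual_enorm g).

End kothe_dual.

(* Order continuity of the lattice of classes of functions in [C], with the
   norm [N] (assumed compatible with a.e. equality on [C]). Nets of classes are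
   given by representatives. *)
Definition order_continuous (C : set (S -> R)) (N : (S -> R) -> R) :=
  forall (I : Type) (le : I -> I -> Prop) (u : I -> S -> R),
  (exists i : I, True) ->
  (forall i, le i i) ->
  (forall i j k, le i j -> le j k -> le i k) ->
  (forall i j, exists k, le i k /\ le j k) ->
  (forall i, C (u i)) ->
  (forall i j, le i j -> {ae mu, forall t, u j t <= u i t}) ->
  (forall i, {ae mu, forall t, 0 <= u i t}) ->
  (forall g, C g -> (forall i, {ae mu, forall t, g t <= u i t}) ->
    {ae mu, forall t, g t <= 0}) ->
  forall e : R, 0 < e -> exists i0, forall i, le i0 i -> N (u i) < e.

End kothe.

Section bochner_measurable.
Context d (S : measurableType d) (R : realType).
Context (mu : {measure set S -> \bar R}) (X : normedModType R).

(* {sfun S >-> _} only covers real-valued simple functions. *)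
Definition simple_fun (s : S -> X) :=
  finite_set (range s) /\ forall x, measurable (s @^-1` [set x]).

Definition bochner_measurable (f : S -> X) :=
  exists s : nat -> S -> X, (forall n, simple_fun (s n)) /\
    {ae mu, forall t, s ^~ t @ \oo --> f t}.

Lemma simple_fun_preimage (s : S -> X) (B : set X) :
  simple_fun s -> measurable (s @^-1` B).
Proof.
move=> [fs ms].
rewrite (_ : _ @^-1` _ = \bigcup_(x in range s `&` B) (s @^-1` [set x])).
  apply: fin_bigcup_measurable => [|x _]; last exact: ms.
  exact: finite_setIl.
apply/seteqP; split=> [t Bst|t [x [_ Bx] /= ->//]].
by exists (s t) => //=; split => //; exists t.
Qed.

Lemma bochner_measurable_cst (x : X) : bochner_measurable (fun=> x).
Proof.
exists (fun _ _ => x); split=> [_|]; last by apply: aeW => t; exact: cvg_cst.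
split=> [|y].
  by apply: (@sub_finite_set _ _ [set x]) => [_ [t _ <-]//|]; exact: finite_set1.
rewrite preimage_cst; case: ifP => _; [exact: measurableT|exact: measurable0].
Qed.

Lemma bochner_measurableD (f g : S -> X) : bochner_measurable f ->
  bochner_measurable g -> bochner_measurable (fun t => f t + g t).
Proof.
move=> [s [ss sf]] [r [sr rg]]; exists (fun n t => s n t + r n t); split.
  move=> n; split.
    apply: (@sub_finite_set _ _
        [set p.1 + p.2 | p in range (s n) `*` range (r n)]).
      by move=> _ [t _ <-]; exists (s n t, r n t) => //; split; exists t.
    by apply/finite_image/finite_setX; [apply: (ss n).1|apply: (sr n).1].
  move=> x; rewrite (_ : _ @^-1` _ = \bigcup_(y in range (s n))
      (s n @^-1` [set y] `&` r n @^-1` [set x - y])).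
    apply: fin_bigcup_measurable => [|y _]; first exact: (ss n).1.
    by apply: measurableI; [exact: (ss n).2|exact: (sr n).2].
  apply/seteqP; split=> [t /= <-|t [y _ [/= -> ->]]]; last by rewrite addrC subrK.
  by exists (s n t); [exists t|split => //=; rewrite addrAC subrr add0r].
by move: sf rg; apply: filterS2 => t; exact: cvgD.
Qed.

Lemma bochner_measurableZ (a : R) (f : S -> X) : bochner_measurable f ->
  bochner_measurable (fun t => a *: f t).
Proof.
move=> [s [ss sf]]; exists (fun n t => a *: s n t); split.
  move=> n; split.
    apply: (@sub_finite_set _ _ [set a *: x | x in range (s n)]).
      by move=> _ [t _ <-]; exists (s n t) => //; exists t.
    by apply: finite_image; exact: (ss n).1.
  move=> x; exact: (simple_fun_preimage [set y | a *: y = x] (ss n)).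
by apply: filterS sf => t; exact: cvgZr.
Qed.

Lemma bochner_measurable_norm (f : S -> X) : measure_is_complete mu ->
  bochner_measurable f -> measurable_fun setT (fun t => `|f t|).
Proof.
move=> cmu [s [ss sf]].
pose A := [set t | s ^~ t @ \oo --> f t].
have negA B : B `<=` ~` A -> measurable B.
  by move=> BA; apply: cmu; apply: negligibleS sf; exact: BA.
have mA : measurable A by rewrite -(setCK A); apply: measurableC; exact: negA.
rewrite -(setvU A); apply/measurable_funU => //; first exact: negA.
split.
  by move=> _ B _; apply: negA => t [].
apply: (@measurable_fun_cvg _ _ _ _ (fun n t => `|s n t|)).
  move=> n _ B _; apply: measurableI => //.
  exact: (simple_fun_preimage [set y | B `|y|] (ss n)).
by move=> t At; exact: cvg_norm.
Qed.

End bochner_measurable.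

Section kothe_bochner.
Context d (S : measurableType d) (R : realType).
Context (mu : {measure set S -> \bar R}) (cmu : measure_is_complete mu).
Context (E : kothe_space mu) (X : normedModType R).

Definition kb_carrier (f : S -> X) : Prop :=
  bochner_measurable mu f /\ E (fun t => `|f t|).

Definition kb_norm (f : S -> X) : R := nfs_norm E (fun t => `|f t|).

Let kb_mem0 : kb_carrier (fun=> 0).
Proof.
split; first exact: bochner_measurable_cst.
rewrite (_ : (fun=> _) = (fun=> 0)); first exact: nfs_mem0.
by apply/funext => t; rewrite normr0.
Qed.

Let kb_normD_aux f g : kb_carrier f -> kb_carrier g ->
  E (fun t => `|f t + g t|) /\ kb_norm (fun t => f t + g t) <=
    nfs_norm E (fun t => `|f t| + `|g t|).
Proof.
move=> [bf Ef] [bg Eg]; apply: ks_ideal.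
- exact: nfs_memD.
- exact: (bochner_measurable_norm cmu (bochner_measurableD bf bg)).
- by apply: aeW => t; rewrite normr_id [leRHS]ger0_norm ?addr_ge0// ler_normD.
Qed.

Let kb_memD f g : kb_carrier f -> kb_carrier g ->
  kb_carrier (fun t => f t + g t).
Proof.
move=> kf kg; split; last exact: (kb_normD_aux kf kg).1.
by apply: bochner_measurableD; [exact: kf.1|exact: kg.1].
Qed.

Let kb_normD f g : kb_carrier f -> kb_carrier g ->
  kb_norm (fun t => f t + g t) <= kb_norm f + kb_norm g.
Proof.
move=> kf kg; apply: le_trans (kb_normD_aux kf kg).2 _.
by apply: nfs_normD; [exact: kf.2|exact: kg.2].
Qed.

Let kb_normZE (a : R) (f : S -> X) :
  (fun t => `|a *: f t|) = (fun t => `|a| *: `|f t|).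
Proof. by apply/funext => t; rewrite normrZ. Qed.

Let kb_memZ (a : R) f : kb_carrier f -> kb_carrier (fun t => a *: f t).
Proof.
move=> [bf Ef]; split; first exact: bochner_measurableZ.
by rewrite kb_normZE; exact: nfs_memZ.
Qed.

Let kb_normZ (a : R) f : kb_carrier f ->
  kb_norm (fun t => a *: f t) = `|a| * kb_norm f.
Proof. by move=> [bf Ef]; rewrite /kb_norm kb_normZE nfs_normZ// normr_id. Qed.

Let kb_norm_eq0 f : kb_carrier f ->
  kb_norm f = 0 <-> {ae mu, forall t, f t = 0}.
Proof.
move=> [bf Ef]; split.
  move=> /(nfs_norm_eq0 Ef); apply: filterS => t /normr0_eq0.
  by apply.
move=> f0; apply/(nfs_norm_eq0 Ef); apply: filterS f0 => t ->.
exact: normr0.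
Qed.

(* Completeness of mu is what makes t |-> `|f t + g t| measurable, hence the
   Bochner-measurable functions with norm in E a vector space. *)
Definition kothe_bochner_space : normed_fun_space mu X :=
  NormedFunSpace kb_mem0 kb_memD kb_memZ kb_normD kb_normZ kb_norm_eq0.

End kothe_bochner.

(* Main.v *)
From HB Require Import structures.
Require Import Defs.
From mathcomp Require Import all_boot all_order all_algebra.
From mathcomp Require Import all_classical all_reals all_analysis.
From mathcomp Require Import measurable_realfun.
From mathcomp Require Import ring lra.
Set Implicit Arguments.
Unset Strict Implicit.
Unset Printing Implicit Defensive.
Import Order.TTheory GRing.Theory Num.Theory.
Import numFieldNormedType.Exports.
Local Open Scope classical_set_scope.
Local Open Scope ring_scope.

(** Let phi be a functional of norm one on E(X), let f and f_n be unit vectors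
of E(X) with |f_n + f| --> 2, and write |f(.)| for the function t |-> |f(t)|.
Local uniform rotundity of E, applied to scalar functions, gives
|f_n(.)| --> |f(.)| and |f_n(.) + f(.)| --> 2|f(.)| in E
([LUR_norm_defect]). Made pointwise, this says that f(t) and f_n(t) satisfy, up
to normalization, the premise of luacs+ in X, for almost every t. It remains to
decompose phi into functionals acting on the values f(t), f_n(t).

Since f and the f_n are countably many functions, phi can be decomposed along
them by densities. A second consequence of the rotundity of E is that its norm is
absolutely continuous ([LUR_absolutely_continuous]). Therefore

  lambda(A) = sup of phi(g) over the g with |g(t)| <= 1_A(t)|f(t)|

is a finite measure ([control_measure]). The functions f_n may be truncated so
that |f_n(t)| <= 2|f(t)|; then A |-> phi(1_A f_n) is a charge dominated by
2 lambda and has a density h_n ([density_exists]); let h be the one of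
A |-> phi(1_A f). Comparing phi with lambda on the sets where a rational
combination of the functions has norm at most q|f(t)| shows
([density_le]) that, for almost every t,

  (a h(t) + sum_i a_i h_i(t)) |f(t)| <= |a f(t) + sum_i a_i f_i(t)|

for all rational a, a_i at once. By the Hahn-Banach theorem some functional of
norm at most one on X maps f(t) to h(t)|f(t)| and every f_n(t) to
h_n(t)|f(t)| ([functional_through_points]). So luacs+ of X
relates h_n(t) --> 1 to h(t) = 1 ([luacs_plus_pointwise]). As phi(f_n) and
phi(f) are the integrals of h_n and h, the total mass of lambda is at most 1
and h_n has pointwise upper limit at most 1, the equivalence between
phi(f_n) --> 1 and phi(f) = 1 follows by integration ([Rintegral_cvg1_iff]).

Convergence in E becomes pointwise along a subsequence, in the sense of lambda,
by the inequality of Markov and the Borel-Cantelli lemma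
([kothe_cvg0_subseq_ae]); passing to subsequences is harmless in both
directions of the equivalence. *)

(** * The Hahn-Banach theorem *)
Section hahn_banach.
Context (R : realType) (V : normedModType R).

(** Partial linear functionals bounded by the norm, encoded by their graphs:
unions of chains are then plain unions of sets. *)
Definition dominated_graph (G : set (V * R)) :=
  [/\ G (0, 0),
      forall a p q, G p -> G q -> G (a *: p.1 + q.1, a * p.2 + q.2) &
      forall p, G p -> p.2 <= `|p.1|].

(** The difference of two values at one point is the second component of an
element of the graph above 0, so domination forces it to be nonpositive. *)
Lemma dominated_graph_unique G v r s :
  dominated_graph G -> G (v, r) -> G (v, s) -> r = s.
Proof.
move=> [_ Glin Gdom]; wlog rs : r s / r <= s.
  by move=> H Gr Gs; case: (leP r s) => [/H|/ltW /H ->//]; exact.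
move=> Gr Gs; apply/eqP; rewrite eq_le rs /=.
have /Gdom /= := Glin (-1) _ _ Gr Gs.
by rewrite scaleN1r addNr normr0 mulN1r addrC subr_le0.
Qed.

(** The one-dimensional extension step: a value c at x is admissible as soon as
r - |v - x| <= c <= |v + x| - r for all (v, r) in the graph, and the triangle
inequality makes these bounds compatible. *)
Lemma dominated_graph_extend G x : dominated_graph G ->
  exists2 H, dominated_graph H & G `<=` H /\ exists c, H (x, c).
Proof.
move=> [G0 Glin Gdom].
pose T := [set p.2 - `|p.1 - x| | p in G].
have Tub v r : G (v, r) -> ubound T (`|v + x| - r).
  move=> Gv _ [[w s] Gw <-] /=; rewrite lerBlDr addrAC lerBrDr.
  have /Gdom /= := Glin 1 _ _ Gw Gv; rewrite scale1r mul1r => /le_trans; apply.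
  have -> : w + v = (v + x) + (w - x) by rewrite addrACA subrr addr0 addrC.
  exact: ler_normD.
have supT : has_sup T.
  by split; [exists (0 - `|0 - x|), (0, 0)|exists (`|0 + x| - 0); exact: Tub].
pose c := sup T.
have c_ge v r : G (v, r) -> r - `|v - x| <= c.
  by move=> Gv; apply: ub_le_sup; [exact: supT.2|exists (v, r)].
have c_le v r : G (v, r) -> c <= `|v + x| - r.
  by move=> Gv; apply: ge_sup; [exact: supT.1|exact: Tub].
pose H := [set q | exists p a, G p /\ q = (p.1 + a *: x, p.2 + a * c)].
exists H; last split.
- split.
  + by exists (0, 0), 0; rewrite scale0r mul0r !addr0.
  + move=> b _ _ [p [a [Gp ->]]] [q [a' [Gq ->]]] /=.
    exists (b *: p.1 + q.1, b * p.2 + q.2), (b * a + a').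
    split; first exact: Glin.
    by congr pair => /=;
      rewrite ?scalerDr ?scalerA ?scalerDl ?mulrDr ?mulrDl ?mulrA addrACA.
  + move=> _ [[v r] [a [Gv ->]]] /=.
    have Gs b : G (b *: v, b * r).
      by have := Glin b _ _ Gv G0; rewrite /= !addr0.
    have [a0|a0|->] := ltgtP a 0; last by rewrite scale0r mul0r !addr0; exact: Gdom Gv.
    * have na : 0 < - a by rewrite oppr_gt0.
      have := c_ge _ _ (Gs (- a)^-1).
      have -> : (- a)^-1 *: v - x = (- a)^-1 *: (v + a *: x).
        by rewrite scalerDr scalerA invrN mulNr mulVf ?lt_eqF// scaleN1r.
      rewrite normrZ gtr0_norm ?invr_gt0// -mulrBr ler_pdivrMl// mulNr.
      lra.
    * have := c_le _ _ (Gs a^-1).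
      have -> : a^-1 *: v + x = a^-1 *: (v + a *: x).
        by rewrite scalerDr scalerA mulVf ?gt_eqF// scale1r.
      rewrite normrZ gtr0_norm ?invr_gt0// -mulrBr ler_pdivlMl//.
      lra.
- by move=> [v r] Gv; exists (v, r), 0; rewrite scale0r mul0r !addr0.
- by exists c, (0, 0), 1; rewrite scale1r mul1r !add0r.
Qed.

(** Zorn's lemma is applied to the sets M such that G together with M is
dominated, rather than to the dominated sets containing G, because the union of
the empty chain must be admissible. *)
Lemma dominated_graph_functional G : dominated_graph G ->
  exists2 psi : {linear V -> R^o}, (forall v, `|psi v| <= `|v|) &
    forall v r, G (v, r) -> psi v = r.
Proof.
move=> dG.
have [F FF totF|M [dM maxM]] := @Zorn_bigcup _ (fun H => dominated_graph (G `|` H)).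
  split.
  + by left; case: dG.
  + move=> a p q Fp Fq.
    have [H [FH Hp Hq]] : exists H, [/\ F H \/ H = set0, (G `|` H) p & (G `|` H) q].
      case: Fp Fq => [Gp|[A FA Ap]] [Gq|[B FB Bq]].
      - by exists set0; split; [right|left|left].
      - by exists B; split; [left|left|right].
      - by exists A; split; [left|right|left].
      - case: (totF _ _ FA FB) => AB.
          by exists B; split; [left|right; exact: AB|right].
        by exists A; split; [left|right|right; exact: AB].
    case: FH => [FH|H0].
      have [_ Hlin _] := FF _ FH.
      by case: (Hlin a _ _ Hp Hq); [left|right; exists H].
    move: Hp Hq; rewrite H0 !setU0 => Gp Gq.
    by left; have [_ Glin _] := dG; exact: Glin.
  + move=> p [Gp|[H FH Hp]]; first by case: dG => _ _; exact.
    by case: (FF _ FH) => _ _; apply; right.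
pose K := G `|` M.
have totK x : exists c, K (x, c).
  have [H dH [KH [c Hc]]] := dominated_graph_extend x dM.
  exists c; apply: contrapT => nKc; apply: (maxM H).
    split; first by move=> p Mp; apply: KH; right.
    by move=> HM; apply: nKc; right; exact: HM.
  by rewrite setUC setUidl// => p Gp; apply: KH; left.
pose psi x := projT1 (cid (totK x)) : R^o.
have Kpsi x : K (x, psi x) by exact: projT2 (cid (totK x)).
have psiE x r : K (x, r) -> psi x = r by exact: dominated_graph_unique.
have psi_lin : linear psi.
  by move=> a u v; apply: psiE; case: dM => _ Klin _; exact: Klin a _ _ (Kpsi u) (Kpsi v).
pose L := GRing.isLinear.Build R V R^o _ psi psi_lin.
pose psiL : {linear V -> R^o} := HB.pack psi L.
exists psiL => [v|v r Gv]; last by apply: psiE; left.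
have le w : psi w <= `|w| by case: dM => _ _ /(_ _ (Kpsi w)).
rewrite ler_norml le andbT lerNl -[X in X <= _](linearN psiL) /=.
by rewrite -normrN le.
Qed.

End hahn_banach.

(** * Functionals with prescribed values *)
Section helly.
Context (R : realType) (V : normedModType R).

Lemma ratr_cvg (a : R) : exists q : nat -> rat, (fun k => ratr (q k) : R) @ \oo --> a.
Proof.
have H (k : nat) : exists q : rat, ratr q \in `]a - k.+1%:R^-1, a + k.+1%:R^-1[.
  by apply: rat_in_itvoo; rewrite ltrD2l gtrN ?invr_gt0.
pose q k := projT1 (cid (H k)).
exists q; apply: (@squeeze_cvgr _ _ _ _ (fun k => a - k.+1%:R^-1) (fun k => a + k.+1%:R^-1)).
- apply: nearW => k; have := projT2 (cid (H k)).
  by rewrite in_itv/= => /andP[/ltW -> /ltW ->].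
- by rewrite -[X in _ --> X]subr0; apply: cvgB; [exact: cvg_cst|exact: cvg_harmonic].
- by rewrite -[X in _ --> X]addr0; apply: cvgD; [exact: cvg_cst|exact: cvg_harmonic].
Qed.

(** The hypothesis is restricted to rational coefficients because it will only be
known almost everywhere for each fixed combination; density extends it to real
coefficients, and it then says that v i |-> c i generates a dominated graph. *)
Lemma functional_through_points (v : nat -> V) (c : nat -> R) :
  (forall s : seq rat, \sum_(i < size s) ratr s`_i * c i <=
                       `|\sum_(i < size s) ratr s`_i *: v i|) ->
  exists2 psi : {linear V -> R^o}, (forall x, `|psi x| <= `|x|) &
    forall i, psi (v i) = c i.
Proof.
move=> Hrat.
have Hreal (n : nat) (a : nat -> R) :
    \sum_(i < n) a i * c i <= `|\sum_(i < n) a i *: v i|.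
  pose q i := projT1 (cid (ratr_cvg (a i))).
  have qa i : (fun k => ratr (q i k) : R) @ \oo --> a i := projT2 (cid (ratr_cvg (a i))).
  have L1 : (fun k => \sum_(i < n) ratr (q i k) * c i) @ \oo --> \sum_(i < n) a i * c i.
    by apply: cvg_big => [|i _]; [exact: pseudometric_normed_Zmodule.add_continuous|apply: cvgMr_tmp; exact: qa].
  have L2 : (fun k => `|\sum_(i < n) ratr (q i k) *: v i|) @ \oo -->
      `|\sum_(i < n) a i *: v i|.
    by apply: cvg_norm; apply: cvg_big => [|i _]; [exact: pseudometric_normed_Zmodule.add_continuous|apply: cvgZ; [exact: qa|exact: cvg_cst]].
  apply: (ler_cvg_to L1 L2); apply: nearW => k.
  have := Hrat (mkseq (q^~ k) n); rewrite size_mkseq.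
  under eq_bigr do rewrite nth_mkseq//.
  by under [X in `|X|]eq_bigr do rewrite nth_mkseq//.
pose G := [set p : V * R | exists n (a : nat -> R), (forall i, (n <= i)%N -> a i = 0) /\
  p = (\sum_(i < n) a i *: v i, \sum_(i < n) a i * c i)].
have widen (W : nmodType) (F : R -> nat -> W) n N (a : nat -> R) : (forall i, F 0 i = 0) ->
    (n <= N)%N -> (forall i, (n <= i)%N -> a i = 0) ->
    \sum_(i < n) F (a i) i = \sum_(i < N) F (a i) i.
  move=> F0 nN a0; rewrite (big_ord_widen N (fun i => F (a i) i))// big_mkcond/=.
  by apply: eq_bigr => i _; case: ltnP => // /a0 ->.
have dG : dominated_graph G.
  split.
  - by exists 0, (fun=> 0); rewrite !big_ord0.
  - move=> b _ _ [n [a [a0 ->]]] [m [a' [a'0 ->]]] /=.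
    exists (maxn n m), (fun i => b * a i + a' i); split.
      by move=> i; rewrite geq_max => /andP[ni mi]; rewrite a0// a'0// mulr0 addr0.
    rewrite (widen _ (fun x i => x *: v i) n (maxn n m))//; last 2 first.
    + by move=> i; rewrite scale0r.
    + exact: leq_maxl.
    rewrite (widen _ (fun x i => x *: v i) m (maxn n m))//; last 2 first.
    + by move=> i; rewrite scale0r.
    + exact: leq_maxr.
    rewrite (widen _ (fun x i => x * c i) n (maxn n m))//; last 2 first.
    + by move=> i; rewrite mul0r.
    + exact: leq_maxl.
    rewrite (widen _ (fun x i => x * c i) m (maxn n m))//; last 2 first.
    + by move=> i; rewrite mul0r.
    + exact: leq_maxr.
    rewrite scaler_sumr mulr_sumr -!big_split/=.
    by congr pair; apply: eq_bigr => i _; rewrite ?scalerDl ?scalerA// mulrDl mulrA.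
  - by move=> _ [n [a [_ ->]]] /=; exact: Hreal.
have [psi psi_le psiE] := dominated_graph_functional dG.
exists psi => // i; apply: psiE; exists i.+1, (fun j => (j == i)%:R); split.
  by move=> j; rewrite ltnNge leq_eqVlt => /norP[]; rewrite eq_sym => /negbTE ->.
rewrite !big_ord_recr/= eqxx scale1r mul1r.
by rewrite !big1 ?add0r// => j _; rewrite ltn_eqF// ?scale0r ?mul0r.
Qed.

End helly.

(** * Rotundity without normalization *)
Section normalization.
Context (R : realType) (V : normedModType R).
Implicit Types (x : V) (u : nat -> V).

(** The value at 0 only has to be a unit vector: sequences whose norms converge to a
positive limit are eventually nonzero. *)
Definition unitize x (y : V) : V :=
  if y == 0 then `|x|^-1 *: x else `|y|^-1 *: y.

Lemma norm_unitize x y : x != 0 -> `|unitize x y| = 1.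
Proof.
by move=> x0; rewrite /unitize; case: ifPn => y0;
  rewrite normrZ normfV normr_id mulVf// normr_eq0.
Qed.

(** At y = 0 both sides are equal to 1, so no case distinction is left to the
users of this lemma. *)
Lemma unitize_dist x y : x != 0 ->
  `|unitize x y - `|x|^-1 *: y| = `|1 - `|x|^-1 * `|y| |.
Proof.
move=> x0; rewrite /unitize; case: (eqVneq y 0) => [->|y0].
  by rewrite scaler0 subr0 normr0 mulr0 subr0 normrZ normfV normr_id mulVf ?normr_eq0// normr1.
rewrite -scalerBl normrZ -[X in _ * X]normr_id -normrM mulrBl mulVf//.
by rewrite normr_eq0.
Qed.

Lemma unitize_cvg x u : x != 0 -> (fun n => `|u n|) @ \oo --> `|x| ->
  (fun n => `|unitize x (u n) - `|x|^-1 *: u n|) @ \oo --> (0 : R).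
Proof.
move=> x0 ux; under eq_fun do rewrite unitize_dist//.
rewrite -(normr0 R) -[X in `|X|](subrr (1 : R)); apply: cvg_norm.
apply: cvgB; first exact: cvg_cst.
by rewrite -[X in _ --> X](@mulVf _ `|x|) ?normr_eq0//; apply: cvgMl_tmp.
Qed.

Lemma cvg_norm_close (u w : nat -> V) l :
  (fun n => `|w n - u n|) @ \oo --> (0 : R) ->
  (fun n => `|u n|) @ \oo --> (l : R) -> (fun n => `|w n|) @ \oo --> l.
Proof.
move=> wu ul.
apply: (@squeeze_cvgr _ _ _ _ (fun n => `|u n| - `|w n - u n|)
    (fun n => `|u n| + `|w n - u n|)).
- apply: nearW => n; rewrite lerBlDr.
  have := ler_normD (w n) (u n - w n); have := ler_normD (u n) (w n - u n).
  by rewrite distrC !subrKC => -> ->.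
- by rewrite -[X in _ --> X]subr0; exact: cvgB.
- by rewrite -[X in _ --> X]addr0; exact: cvgD.
Qed.

Lemma unitize_addr x u : x != 0 -> (fun n => `|u n|) @ \oo --> `|x| ->
  (fun n => `|u n + x|) @ \oo --> 2 * `|x| ->
  (fun n => `|unitize x (u n) + `|x|^-1 *: x|) @ \oo --> (2 : R).
Proof.
move=> x0 ux uxx.
apply: (@cvg_norm_close (fun n => `|x|^-1 *: (u n + x))).
  under eq_fun => n do rewrite scalerDr opprD addrACA subrr addr0.
  exact: unitize_cvg.
under eq_fun do rewrite normrZ normfV normr_id.
have -> : (2 : R) = `|x|^-1 * (2 * `|x|).
  by rewrite mulrCA mulVf ?normr_eq0// mulr1.
exact: cvgMl_tmp.
Qed.

(** Both u n and x are divided by |x| up to an error tending to 0, which reduces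
the claim to unit vectors. *)
Lemma LUR_cvg x u : LUR V -> (fun n => `|u n|) @ \oo --> `|x| ->
  (fun n => `|u n + x|) @ \oo --> 2 * `|x| ->
  (fun n => `|u n - x|) @ \oo --> (0 : R).
Proof.
move=> lurV ux uxx; have [x0|x0] := eqVneq x 0.
  have -> : (fun n => `|u n - x|) = (fun n => `|u n|).
    by apply/funext => n; rewrite x0 subr0.
  by move: ux; rewrite x0 normr0.
have xu : `| `|x|^-1 *: x| = 1 by rewrite normrZ normfV normr_id mulVf// normr_eq0.
have H := lurV _ (fun n => unitize x (u n)) xu (fun n => norm_unitize (u n) x0)
  (unitize_addr x0 ux uxx).
have K : (fun n => `| `|x|^-1 *: (u n - x)|) @ \oo --> (0 : R).
  apply: cvg_norm_close H.
  under eq_fun => n do rewrite scalerBr opprB addrA subrK distrC.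
  exact: unitize_cvg.
have -> : (fun n => `|u n - x|) = (fun n => `|x| * `| `|x|^-1 *: (u n - x)|).
  by apply/funext => n; rewrite normrZ normfV normr_id mulrA divff ?mul1r// normr_eq0.
by rewrite -[X in _ --> X](mulr0 `|x|); exact: cvgMl_tmp.
Qed.

(** A functional bounded by the norm has dual norm one as soon as it comes close
to one on unit vectors, which either side of the equivalence guarantees. *)
Lemma luacs_plus_cvg x u (psi : {linear V -> R^o}) : luacs_plus V -> x != 0 ->
  (forall y, `|psi y| <= `|y|) -> (fun n => `|u n|) @ \oo --> `|x| ->
  (fun n => `|u n + x|) @ \oo --> 2 * `|x| ->
  ((fun n => psi (u n) : R) @ \oo --> `|x|) <-> psi x = `|x|.
Proof.
move=> acsV x0 psi_le ux uxx.
have xn0 : `|x| != 0 by rewrite normr_eq0.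
have xu : `| `|x|^-1 *: x| = 1 by rewrite normrZ normfV normr_id mulVf.
have cpsi : continuous (psi : V -> R^o).
  apply: bounded_linear_continuous; rewrite linear_boundedP.
  by near=> M => y; apply: (le_trans (psi_le y)); rewrite ler_peMl// .
have psi_norm (l : R) : l = 1 -> (exists w : nat -> V, (forall n, `|w n| = 1) /\
    (fun n => psi (w n) : R) @ \oo --> l) -> dual_norm psi = 1.
  move=> -> [w [w1 wl]].
  have ub1 : ubound [set `|psi x| | x in [set x : V | `|x| <= 1]] 1.
    by move=> _ [y /= y1 <-]; exact: le_trans (psi_le y) y1.
  apply/eqP; rewrite eq_le; apply/andP; split.
    by apply: ge_sup => //; exists `|psi 0|, 0 => //=; rewrite normr0.
  apply: (@cvgr_to_le _ _ _ _ (fun n => psi (w n) : R) _ _ wl).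
  apply: nearW => n; apply: (le_trans (ler_norm _)); apply: ub_le_sup.
    by exists 1.
  by exists (w n) => //=; rewrite w1.
have acs := acsV _ (fun n => unitize x (u n)) xu (fun n => norm_unitize (u n) x0)
  (unitize_addr x0 ux uxx) psi.
have psiV y : psi (`|x|^-1 *: y) = `|x|^-1 * psi y :> R by rewrite linearZ.
have small : (fun n => psi (unitize x (u n) - `|x|^-1 *: u n) : R) @ \oo --> (0 : R).
  apply: (@norm_cvg0 _ R^o).
  apply: (@squeeze_cvgr _ _ _ _ (fun=> 0) (fun n => `|unitize x (u n) - `|x|^-1 *: u n|)).
  - by apply: nearW => n; rewrite normr_ge0 psi_le.
  - exact: cvg_cst.
  - exact: unitize_cvg.
split=> H.
  have psiw : (fun n => psi (unitize x (u n)) : R) @ \oo --> (1 : R).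
    have -> : (fun n => psi (unitize x (u n)) : R) = (fun n =>
        psi (unitize x (u n) - `|x|^-1 *: u n) + `|x|^-1 * (psi (u n) : R)).
      by apply/funext => n; rewrite linearB/= psiV subrK.
    rewrite -[X in _ --> X]add0r -[X in _ --> _ + X](mulVf xn0).
    by apply: cvgD => //; exact: cvgMl_tmp.
  have dpsi : dual_sphere psi.
    split=> //; apply: (@psi_norm 1 erefl).
    by exists (fun n => unitize x (u n)); split => // n; exact: norm_unitize.
  have /(acs dpsi) := psiw; rewrite psiV => /(congr1 (fun r => `|x| * r)).
  by rewrite mulrA divff// mul1r mulr1.
have psix : psi (`|x|^-1 *: x) = 1 by rewrite psiV H mulVf.
have dpsi : dual_sphere psi.
  split=> //; apply: (@psi_norm 1 erefl).
  by exists (fun=> `|x|^-1 *: x); split => //; rewrite psix; exact: cvg_cst.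
have /(acs dpsi) psiw := psix.
have -> : (fun n => psi (u n) : R) = (fun n =>
    `|x| * (psi (unitize x (u n)) - psi (unitize x (u n) - `|x|^-1 *: u n) : R)).
  apply/funext => n; rewrite linearB/= psiV opprB addrC subrK.
  by rewrite mulrA divff// mul1r.
have := @cvgMl_tmp _ _ _ _ _ `|x| _ (cvgB psiw small).
by rewrite subr0 mulr1; apply.
Unshelve. all: by end_near. Qed.

End normalization.

(** * Absolute continuity of a locally uniformly rotund Köthe norm *)

(** A monotone function has only countably many jumps, and an interval is
uncountable. *)
Lemma nondecreasing_left_continuous_point (R : realType) (g : R -> R) :
  {homo g : x y / x <= y} -> exists x, forall e, 0 < e -> exists2 y, y < x & g x - g y < e.
Proof.
move=> ndg.
have nd01 : {in `[0, 1] &, nondecreasing_fun g} by move=> x y _ _; exact: ndg.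
have [x x01 cx] : exists2 x, x \in `]0, 1[ & ~ discontinuity g x.
  apply: contrapT => nx; have := countable_lebesgue_measure0 (discontinuity_countable nd01).
  rewrite (_ : [set x | _] = `]0, 1[%classic).
    by rewrite lebesgue_measure_itv/= lte01 sube0 => -[] /eqP; rewrite oner_eq0.
  apply/seteqP; split=> [x []//|x x01]; split => //.
  by apply: contrapT => dx; apply: nx; exists x.
have cl : cvg (g y @[y --> x^'-]).
  apply: nondecreasing_at_left_is_cvgr; first by apply: nearW => y u v _ _; exact: ndg.
  near=> y; exists (g x) => _ [z /= + <-]; rewrite in_itv/= => /andP[_ zx].
  exact/ndg/ltW.
have cr : cvg (g y @[y --> x^'+]).
  apply: nondecreasing_at_right_is_cvgr; first by apply: nearW => y u v _ _; exact: ndg.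
  near=> y; exists (g x) => _ [z /= + <-]; rewrite in_itv/= => /andP[xz _].
  exact/ndg/ltW.
have lr : lim (g y @[y --> x^'-]) = lim (g y @[y --> x^'+]).
  by apply/eqP; rewrite -[_ == _]negbK; apply/negP => nlr; apply: cx; split.
have gx : g x <= lim (g y @[y --> x^'-]).
  rewrite lr; apply: limr_ge => //; near=> y; apply: ndg; near: y.
  exact: nbhs_right_ge.
exists x => e e0; near x^'- => y; exists y => //.
have : `|lim (g y @[y --> x^'-]) - g y| < e.
  by near: y; exact: (@cvgr_dist_lt _ _ _ _ _ _ _ cl).
by move=> /(le_lt_trans (ler_norm _)); apply: le_lt_trans; exact: lerB.
Unshelve. all: by end_near. Qed.

Section ae_class_norm.
Context d (S : measurableType d) (R : realType).
Context (mu : {measure set S -> \bar R}) (X : normedModType R).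
Variable F : normed_fun_space mu X.

Lemma nfs_memB f g : F f -> F g -> F (fun t => f t - g t).
Proof.
move=> Ff Fg; have := nfs_memD Ff (nfs_memZ (-1) Fg).
by congr (nfs_carrier F _); apply/funext => t; rewrite scaleN1r.
Qed.

Lemma ae_class_of_repr (x : ae_class F) (Fx : F (ae_repr x)) : ae_class_of Fx = x.
Proof. by rewrite -[RHS]ae_reprK; apply/ae_class_of_eq/aeW. Qed.

Lemma nfs_norm_ge0 f : F f -> 0 <= nfs_norm F f.
Proof. by move=> Ff; rewrite -(ae_class_of_norm Ff). Qed.

Lemma ae_class_of_normD f g (Ff : F f) (Fg : F g) :
  `|ae_class_of Ff + ae_class_of Fg| = nfs_norm F (fun t => f t + g t).
Proof. by rewrite ae_class_ofD ae_class_of_norm. Qed.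

Lemma ae_class_of_normB f g (Ff : F f) (Fg : F g) :
  `|ae_class_of Ff - ae_class_of Fg| = nfs_norm F (fun t => f t - g t).
Proof.
rewrite -scaleN1r ae_class_ofZ ae_class_of_normD.
by congr (nfs_norm F _); apply/funext => t; rewrite scaleN1r.
Qed.

Lemma LUR_nfs_cvg f (u : nat -> S -> X) : LUR (ae_class F) -> F f -> (forall n, F (u n)) ->
  (fun n => nfs_norm F (u n)) @ \oo --> nfs_norm F f ->
  (fun n => nfs_norm F (fun t => u n t + f t)) @ \oo --> 2 * nfs_norm F f ->
  (fun n => nfs_norm F (fun t => u n t - f t)) @ \oo --> (0 : R).
Proof.
move=> lurF Ff Fu uf uff.
have := @LUR_cvg R _ (ae_class_of Ff) (fun n => ae_class_of (Fu n)) lurF.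
rewrite ae_class_of_norm.
have -> : (fun n => `|ae_class_of (Fu n)|) = (fun n => nfs_norm F (u n)).
  by apply/funext => n; exact: ae_class_of_norm.
have -> : (fun n => `|ae_class_of (Fu n) + ae_class_of Ff|) =
    (fun n => nfs_norm F (fun t => u n t + f t)).
  by apply/funext => n; exact: ae_class_of_normD.
have -> : (fun n => `|ae_class_of (Fu n) - ae_class_of Ff|) =
    (fun n => nfs_norm F (fun t => u n t - f t)).
  by apply/funext => n; exact: ae_class_of_normB.
exact.
Qed.

End ae_class_norm.

Section restriction.
Context d (S : measurableType d) (R : realType) (V : normedModType R).
Implicit Types (f g : S -> V) (A B : set S).

Definition restr f A : S -> V := fun t => (\1_A t : R) *: f t.

Lemma restr_in f A t : A t -> restr f A t = f t.
Proof. by move=> At; rewrite /restr indicE mem_set ?scale1r. Qed.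

Lemma restr_out f A t : ~ A t -> restr f A t = 0.
Proof. by move=> At; rewrite /restr indicE memNset ?scale0r. Qed.

Lemma restrZ a f A : restr (fun t => a *: f t) A = (fun t => a *: restr f A t).
Proof. by apply/funext => t; rewrite /restr !scalerA mulrC. Qed.

Lemma restrD f g A : restr (fun t => f t + g t) A = (fun t => restr f A t + restr g A t).
Proof. by apply/funext => t; rewrite /restr scalerDr. Qed.

Lemma restrB f A B : A `<=` B -> (fun t => restr f B t - restr f A t) = restr f (B `\` A).
Proof.
move=> AB; apply/funext => t; have [At|At] := pselect (A t).
  by rewrite (restr_in f At) (restr_in f (AB _ At)) restr_out ?subrr// => -[].
rewrite [restr f A t]restr_out// subr0; have [Bt|Bt] := pselect (B t).
  by rewrite !restr_in.
by rewrite !restr_out// => -[].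
Qed.

End restriction.

Lemma norm_restr d (S : measurableType d) (R : realType) (V : normedModType R)
  (f : S -> V) (A : set S) : (fun t => `|restr f A t|) = restr (fun t => `|f t|) A.
Proof.
by apply/funext => t; have [At|At] := pselect (A t);
  rewrite ?(restr_in _ At) ?(restr_out _ At)// normr0.
Qed.

Section absolute_continuity.
Context d (S : measurableType d) (R : realType).
Context (mu : {measure set S -> \bar R}) (E : kothe_space mu).
Local Notation N := (nfs_norm E).
Implicit Types (f g : S -> R) (A B : set S).

Lemma kothe_le f g : E f -> measurable_fun setT g -> (forall t, `|g t| <= `|f t|) ->
  E g /\ N g <= N f.
Proof. by move=> Ef mg gf; apply: ks_ideal => //; exact: aeW. Qed.

Lemma kothe_abs f : E f -> E (fun t => `|f t|) /\ N (fun t => `|f t|) = N f.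
Proof.
move=> Ef; have mf := ks_measurable Ef.
have [Ea fle] : E (fun t => `|f t|) /\ N (fun t => `|f t|) <= N f.
  apply: kothe_le => //; last by move=> t; rewrite normr_id.
  exact: measurableT_comp.
split => //; apply/eqP; rewrite eq_le fle/=.
by have [] : E f /\ N f <= N (fun t => `|f t|) by apply: kothe_le => // t; rewrite normr_id.
Qed.

Lemma measurable_restr f A : E f -> measurable A -> measurable_fun setT (restr f A).
Proof. by move=> Ef mA; apply: measurable_funM; [exact: measurable_indic|exact: ks_measurable Ef]. Qed.

Lemma kothe_restr f A : E f -> measurable A -> E (restr f A) /\ N (restr f A) <= N f.
Proof.
move=> Ef mA; apply: kothe_le => //; first exact: measurable_restr.
by move=> t; have [/restr_in ->//|/restr_out ->] := pselect (A t); rewrite normr0.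
Qed.

Lemma norm_restr_le f A B : E f -> measurable A -> measurable B -> A `<=` B ->
  N (restr f A) <= N (restr f B).
Proof.
move=> Ef mA mB AB; apply: (kothe_le _ _ _).2; first exact: (kothe_restr Ef mB).1.
  exact: measurable_restr.
move=> t; have [At|/restr_out ->] := pselect (A t); last by rewrite normr0.
by rewrite !restr_in//; exact: AB.
Qed.

(** Suppose all the blocks have norm at least e. Reindex them by the rationals and
let B x be the union of the blocks of index less than x: this is an uncountable
chain, along which the norm of the restriction of f is a nondecreasing function
of x. At a point x of left continuity of that function, there are y k < x such that
the norms of the restrictions of f to B (y k) converge to the norm of the
restriction to B x, which dominates them. Rotundity then forces these restrictions
to converge in norm, although the difference always contains a block. *)
Lemma LUR_small_block f (D : nat -> set S) : LUR (ae_class E) -> E f ->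
  (forall n, measurable (D n)) -> trivIset setT D ->
  forall e, 0 < e -> exists n, N (restr f (D n)) < e.
Proof.
move=> lurE Ef mD tD e e0; apply: contrapT => /forallNP nD.
have {}nD n : e <= N (restr f (D n)) by rewrite leNgt; apply/negP; exact: nD.
(* Block n carries the rational with code n; blocks without a rational belong to
   no B x. *)
pose J (x : R) := [set n | exists2 q : rat, unpickle n = Some q & ratr q < x].
pose B x := \bigcup_(n in J x) D n.
have mB x : measurable (B x) by exact: bigcup_measurable.
have BB x y : x <= y -> B x `<=` B y.
  by move=> xy t [n [q nq qx] Dt]; exists n => //; exists q => //; exact: lt_le_trans xy.
have EB x : E (restr f (B x)) by exact: (kothe_restr Ef (mB x)).1.
have [x xP] : exists x, forall e', 0 < e' -> exists2 y, y < x &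
    N (restr f (B x)) - N (restr f (B y)) < e'.
  apply: (@nondecreasing_left_continuous_point _ (fun x => N (restr f (B x)))).
  by move=> x y xy; apply: norm_restr_le => //; exact: BB.
have /choice[y yP] : forall k : nat, exists y, y < x /\
    N (restr f (B x)) - N (restr f (B y)) < k.+1%:R^-1.
  by move=> k; have [|y yx ?] := xP k.+1%:R^-1; [rewrite invr_gt0|exists y].
have c1 : (fun k => N (restr f (B (y k)))) @ \oo --> N (restr f (B x)).
  apply: (@squeeze_cvgr _ _ _ _ (fun k => N (restr f (B x)) - k.+1%:R^-1)
      (fun=> N (restr f (B x)))).
  - apply: nearW => k; have [yx /ltW yk] := yP k.
    rewrite lerBlDr -lerBlDl yk/=; apply: norm_restr_le => //.
    exact/BB/ltW.
  - by rewrite -[X in _ --> X]subr0; apply: cvgB; [exact: cvg_cst|exact: cvg_harmonic].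
  - exact: cvg_cst.
have c2 : (fun k => N (fun t => restr f (B (y k)) t + restr f (B x) t)) @ \oo -->
    2 * N (restr f (B x)).
  apply: (@squeeze_cvgr _ _ _ _ (fun k => 2 * N (restr f (B (y k))))
      (fun k => N (restr f (B (y k))) + N (restr f (B x)))).
  - apply: nearW => k; apply/andP; split; last exact: nfs_normD.
    rewrite -[X in X * N _]gtr0_norm// -nfs_normZ//.
    apply: (kothe_le _ _ _).2.
    + exact: nfs_memD.
    + exact/ks_measurable/nfs_memZ.
    + move=> t; have [At|/restr_out ->] := pselect (B (y k) t); last by rewrite scaler0 normr0.
      rewrite !restr_in//; last by apply: BB At; exact/ltW/(yP k).1.
      by rewrite -mulr2n scaler_nat.
  - exact: cvgMl_tmp.
  - by rewrite mulr_natl mulr2n; apply: cvgD => //; exact: cvg_cst.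
have := LUR_nfs_cvg lurE (EB x) (fun k => EB (y k)) c1 c2.
move=> /cvgrPdist_lt /(_ e e0) [k _ /(_ k (leqnn k))] /=.
rewrite sub0r normrN ger0_norm; last by apply/nfs_norm_ge0/nfs_memB.
apply/negP; rewrite -leNgt.
have [yx _] := yP k.
have -> : N (fun t => restr f (B (y k)) t - restr f (B x) t) = N (restr f (B x `\` B (y k))).
  rewrite -restrB; last exact/BB/ltW.
  have := nfs_normZ (-1) (nfs_memB (EB x) (EB (y k))).
  rewrite normrN1 mul1r => <-; congr (N _); apply/funext => t.
  by rewrite scaleN1r opprB.
have [q] := rat_in_itvoo yx; rewrite in_itv/= => /andP[yq qx].
apply: (le_trans (nD (pickle q))); apply: norm_restr_le => //; first exact: measurableD.
move=> t Dt; split; first by exists (pickle q) => //; exists q; rewrite ?pickleK.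
move=> [n [q' nq' q'y] Dnt].
have En : n = pickle q by apply: (tD n (pickle q)) => //; exists t.
by move: nq'; rewrite En pickleK => -[qq']; move: q'y; rewrite -qq' ltNge (ltW yq).
Qed.

(** If the norms of the pieces A n minus A m did not become small, disjoint pieces
would contradict the previous lemma. So the restrictions of f to the complements
of the A n form a Cauchy sequence; completeness of E gives it a limit, which has
to be f since it agrees with f outside each A n. *)
Lemma LUR_absolutely_continuous f (A : nat -> set S) : LUR (ae_class E) -> E f ->
  (forall n, measurable (A n)) -> (forall n m, (n <= m)%N -> A m `<=` A n) ->
  (forall t, exists n, ~ A n t) ->
  (fun n => N (restr f (A n))) @ \oo --> (0 : R).
Proof.
move=> lurE Ef mA ndA A0.
(* Otherwise next n is the end of a piece of norm at least e starting at n, and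
   iterating next gives disjoint pieces. *)
have tail e : 0 < e -> exists n, forall m, (n <= m)%N -> N (restr f (A n `\` A m)) < e.
  move=> e0; apply: contrapT => /forallNP nA.
  have /choice[next nextP] : forall n, exists m, (n <= m)%N /\ e <= N (restr f (A n `\` A m)).
    move=> n; have /existsNP[m /not_implyP[nm /negP]] := nA n.
    by rewrite -leNgt; exists m.
  pose n_ i := iter i next 0%N.
  have n_le i j : (i <= j)%N -> (n_ i <= n_ j)%N.
    move=> /subnK <-; elim: (j - i)%N => // k IH; rewrite addSn.
    by apply: (leq_trans IH); exact: (nextP _).1.
  have [||i] := @LUR_small_block f (fun i => A (n_ i) `\` A (n_ i.+1)) lurE Ef _ _ e e0.
  - by move=> i; exact: measurableD.
  - apply: ltn_trivIset => i j ij; apply/seteqP; split => // t [[_ nA1] [A2 _]].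
    by apply: nA1; apply: ndA A2; exact: n_le.
  - by apply/negP; rewrite -leNgt; exact: (nextP _).2.
have mC n : measurable (~` A n) by exact: measurableC.
have EC n : E (restr f (~` A n)) := (kothe_restr Ef (mC n)).1.
pose c n : ae_class E := ae_class_of (EC n).
have distc n m : (n <= m)%N -> `|c m - c n| = N (restr f (A n `\` A m)).
  move=> nm; rewrite ae_class_of_normB restrB; last exact/subsetC/ndA.
  by rewrite setDE setCK setIC.
have cc : cauchy (c @ \oo).
  apply: cauchy_exP => e e0; have [n nP] := tail e e0; exists (c n), n => // m /= nm.
  by rewrite -ball_normE/= distrC distc//; exact: nP.
have [l cl] : exists l : ae_class E, c @ \oo --> l.
  by exists (lim (c @ \oo)); exact: ks_banach.
pose g := ae_repr l; have Eg : E g := ae_reprP l.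
have lg : l = ae_class_of Eg by rewrite ae_class_of_repr.
have Ngf : (fun n => N (fun t => restr f (~` A n) t - g t)) @ \oo --> (0 : R).
  have -> : (fun n => N (fun t => restr f (~` A n) t - g t)) = (fun n => `|c n - l|).
    by apply/funext => n; rewrite lg ae_class_of_normB.
  rewrite -(normr0 (ae_class E)) -(subrr l); apply: cvg_norm; apply: cvgB => //.
  exact: cvg_cst.
have fg : {ae mu, forall t, f t = g t}.
  have : {ae mu, forall t, forall k, restr (fun t => f t - g t) (~` A k) t = 0}.
    apply/ae_foralln => k.
    have [Ek _] := kothe_restr (nfs_memB Ef Eg) (mC k).
    apply/(nfs_norm_eq0 Ek)/eqP; rewrite eq_le nfs_norm_ge0// andbT.
    apply: (ler_cvg_to (cvg_cst _) Ngf); exists k => // n /= kn.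
    apply: (kothe_le _ _ _).2; [exact: nfs_memB|by apply: ks_measurable; exact: Ek|].
    move=> t; have [At|/restr_out ->] := pselect ((~` A k) t); last by rewrite normr0.
    by rewrite !restr_in// => Ant; apply: At; exact: ndA Ant.
  apply: filterS => t tP; have [k Ak] := A0 t.
  by have := tP k; rewrite restr_in// => /eqP; rewrite subr_eq0 => /eqP.
have lf : l = ae_class_of Ef by rewrite lg; apply/ae_class_of_eq; apply: filterS fg => t ->.
have -> : (fun n => N (restr f (A n))) = (fun n => `|l - c n|).
  apply/funext => n; rewrite lf ae_class_of_normB.
  congr (N _); apply/funext => t; have [At|At] := pselect (A n t).
    by rewrite restr_in// restr_out ?subr0// => /(_ At).
  by rewrite restr_out// restr_in ?subrr.
rewrite -(normr0 (ae_class E)) -(subrr l); apply: cvg_norm; apply: cvgB => //.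
exact: cvg_cst.
Qed.

End absolute_continuity.

(** * The control measure of a functional *)
Section sigma_additivity.
Context d (S : measurableType d) (R : realType).

Definition continuous_at_empty (v : set S -> R) := forall A : nat -> set S,
  (forall n, measurable (A n)) -> (forall n m, (n <= m)%N -> A m `<=` A n) ->
  (forall t, exists n, ~ A n t) -> v \o A @ \oo --> (0 : R).

Lemma continuous_at_empty_sigma_additive (v : set S -> R) :
  v set0 = 0 ->
  (forall A B, measurable A -> measurable B -> A `&` B `<=` set0 ->
    v (A `|` B) = v A + v B) ->
  continuous_at_empty v -> semi_sigma_additive (EFin \o v).
Proof.
move=> v0 vU vc F mF tF mUF.
pose T n := (\bigcup_i F i) `\` \big[setU/set0]_(i < n) F i.
have mB n : measurable (\big[setU/set0]_(i < n) F i) by exact: bigsetU_measurable.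
have sumE n : \sum_(0 <= i < n) v (F i) = v (\big[setU/set0]_(i < n) F i).
  elim: n => [|n IH]; first by rewrite big_geq// big_ord0 v0.
  have disj : \big[setU/set0]_(i < n) F i `&` F n `<=` set0.
    move=> t []; rewrite -bigcup_mkord => -[i /= ni Fi] Fn.
    have : i = n by apply: (tF i n) => //; exists t.
    by move=> ein; rewrite ein ltnn in ni.
  by rewrite big_nat_recr//= IH big_ord_recr/= (vU _ _ (mB n) (mF n) disj).
have sumT n : \sum_(0 <= i < n) v (F i) = v (\bigcup_i F i) - v (T n).
  have disj : \big[setU/set0]_(i < n) F i `&` T n `<=` set0 by move=> t [Bt [_ nBt]].
  rewrite sumE; apply/eqP; rewrite eq_sym subr_eq -(vU _ _ (mB n) _ disj); last exact: measurableD.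
  rewrite /T setDUK// -bigcup_mkord => t [i _ Fi]; by exists i.
have cT : v \o T @ \oo --> (0 : R).
  apply: vc.
  - by move=> n; exact: measurableD.
  - move=> n m nm t [Ut nBt]; split => // Bt; apply: nBt; move: Bt.
    rewrite -!bigcup_mkord => -[i /= im Fi]; exists i => //=.
    exact: leq_trans im nm.
  - move=> t; have [[i _ Fi]|nU] := pselect ((\bigcup_i F i) t); last by exists 0 => -[].
    exists i.+1 => -[_]; apply; rewrite -bigcup_mkord; exists i => //=.
have -> : (fun n => (\sum_(0 <= i < n) (EFin \o v) (F i))%E) =
    EFin \o (fun n => v (\bigcup_i F i) - v (T n)).
  by apply/funext => n; rewrite /= -sumT sumEFin.
apply: cvg_EFin; first by apply: nearW.
have := cvgB (cvg_cst (v (\bigcup_i F i))) cT; rewrite subr0; exact.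
Qed.

End sigma_additivity.

Section kothe_bochner_functional.
Context d (S : measurableType d) (R : realType).
Context (mu : {measure set S -> \bar R}) (cmu : measure_is_complete mu).
Context (E : kothe_space mu) (X : normedModType R).
Local Notation K := (kothe_bochner_space cmu E X).
Local Notation N := (nfs_norm E).
Implicit Types (f g : S -> X) (A B : set S).

Lemma kb_dominated h f : E h -> bochner_measurable mu f -> (forall t, `|f t| <= `|h t|) ->
  K f /\ nfs_norm K f <= N h.
Proof.
move=> Eh bf fh; have [Ef lef] : E (fun t => `|f t|) /\ N (fun t => `|f t|) <= N h.
  apply: (kothe_le Eh); first exact: (bochner_measurable_norm cmu bf).
  by move=> t; rewrite normr_id.
by split.
Qed.

Lemma bochner_measurable_restr g A : bochner_measurable mu g -> measurable A ->
  bochner_measurable mu (restr g A).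
Proof.
move=> [s [ss sg]] mA; exists (fun n => restr (s n) A); split; last first.
  by apply: filterS sg => t; exact: cvgZl_tmp.
move=> n; split.
  apply: (@sub_finite_set _ _ (range (s n) `|` [set 0])).
    move=> _ [t _ <-]; have [At|At] := pselect (A t).
      by left; exists t => //; rewrite restr_in.
    by right; rewrite restr_out.
  by rewrite finite_setU; split; [exact: (ss n).1|exact: finite_set1].
move=> x; rewrite (_ : _ @^-1` _ = (A `&` s n @^-1` [set x]) `|`
    (~` A `&` [set _ | (0 : X) = x])); last first.
  apply/seteqP; split=> t /=; have [At|At] := pselect (A t).
  - by rewrite restr_in// => ->; left.
  - by rewrite restr_out// => ->; right.
  - by rewrite restr_in// => -[[]|[]].
  - by rewrite restr_out// => -[[]|[]].
apply: measurableU; apply: measurableI => //; first exact: (ss n).2.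
  exact: measurableC.
have [x0|x0] := pselect ((0 : X) = x).
  by rewrite (_ : [set _ | _] = setT)// -subTset => t.
by rewrite (_ : [set _ | _] = set0)// -subset0 => t.
Qed.

Lemma kb_restr g A : K g -> measurable A -> K (restr g A).
Proof.
move=> [bg Eg] mA; split; first exact: bochner_measurable_restr.
by rewrite norm_restr; exact: (kothe_restr Eg mA).1.
Qed.

Context (Phi : (S -> X) -> R).
Hypothesis PhiD : forall f g, K f -> K g -> Phi (fun t => f t + g t) = Phi f + Phi g.
Hypothesis PhiZ : forall a f, K f -> Phi (fun t => a *: f t) = a * Phi f.
Hypothesis Phi_le : forall f, K f -> Phi f <= nfs_norm K f.
Context (f : S -> X) (Kf : K f).
Let nf := fun t => `|f t|.
Hypothesis f_ac : continuous_at_empty (fun A => N (restr nf A)).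

Let Enf : E nf. Proof. exact: Kf.2. Qed.

Lemma functional_restrU g A B : K g -> measurable A -> measurable B -> A `&` B `<=` set0 ->
  Phi (restr g (A `|` B)) = Phi (restr g A) + Phi (restr g B).
Proof.
move=> Kg mA mB AB; rewrite -PhiD; [|exact: kb_restr..].
congr Phi; apply/funext => t; have [At|At] := pselect (A t).
  rewrite (restr_in _ At) (restr_in g (_ : (A `|` B) t)); last by left.
  by rewrite restr_out ?addr0// => Bt; exact: (AB t).
rewrite (restr_out _ At) add0r; have [Bt|Bt] := pselect (B t).
  by rewrite !restr_in//; right.
by rewrite !restr_out// => -[].
Qed.

Lemma functional0 : Phi (fun=> 0) = 0.
Proof.
have := PhiZ 0 (nfs_mem0 K); rewrite mul0r => <-.
by congr Phi; apply/funext => t; rewrite scaler0.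
Qed.

Let below A g := K g /\ forall t, `|g t| <= restr nf A t.

Let lam A := sup [set Phi g | g in below A].

Let restr_nf_ge0 A t : 0 <= restr nf A t.
Proof. by apply: mulr_ge0; [rewrite indicE; case: (_ \in _)|exact: normr_ge0]. Qed.

Let below0 A : below A (fun=> 0).
Proof. by split; [exact: nfs_mem0|move=> t; rewrite normr0]. Qed.

Let Phi_below A g : measurable A -> below A g -> Phi g <= N (restr nf A).
Proof.
move=> mA [Kg gA]; apply: (le_trans (Phi_le Kg)).
apply: (kb_dominated (kothe_restr Enf mA).1 Kg.1 _).2 => t.
by rewrite (le_trans (gA t))// ler_norm.
Qed.

Let lam_has_sup A : has_sup [set Phi g | g in below A].
Proof.
split; first by exists (Phi (fun=> 0)), (fun=> 0).
exists (N nf) => _ [g [Kg gA] <-]; apply: (le_trans (Phi_le Kg)).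
apply: (kb_dominated Enf Kg.1 _).2 => t; apply: (le_trans (gA t)).
by rewrite /nf normr_id; have [/restr_in ->|/restr_out ->] := pselect (A t).
Qed.

Let Phi_lam A g : below A g -> Phi g <= lam A.
Proof. by move=> Ag; apply: ub_le_sup; [exact: (lam_has_sup A).2|exists g]. Qed.

Let lam_le A r : (forall g, below A g -> Phi g <= r) -> lam A <= r.
Proof. by move=> H; apply: ge_sup; [exact: (lam_has_sup A).1|move=> _ [g /H Hg <-]]. Qed.

Let lam_ge0 A : 0 <= lam A.
Proof. by rewrite -functional0; apply: Phi_lam; exact: below0. Qed.

Let lamU A B : measurable A -> measurable B -> A `&` B `<=` set0 ->
  lam (A `|` B) = lam A + lam B.
Proof.
move=> mA mB AB; have AB' := AB; apply/eqP; rewrite eq_le; apply/andP; split.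
  apply: lam_le => g [Kg gAB].
  have -> : g = restr g (A `|` B).
    apply/funext => t; have [ABt|ABt] := pselect ((A `|` B) t); first by rewrite restr_in.
    by rewrite restr_out//; apply/normr0_eq0/le_anti; have := gAB t; rewrite restr_out// normr_ge0 => ->.
  rewrite functional_restrU//.
  have gle C : measurable C -> C `<=` A `|` B -> below C (restr g C).
    move=> mC CAB; split; first exact: kb_restr.
    move=> t; have [Ct|Ct] := pselect (C t); last by rewrite restr_out// normr0.
    by rewrite restr_in// (le_trans (gAB t))// !restr_in//; exact: CAB.
  by apply: lerD; apply: Phi_lam; apply: gle.
rewrite -lerBrDr; apply: lam_le => g [Kg gA]; rewrite lerBrDr addrC -lerBrDr.
apply: lam_le => h [Kh hB]; rewrite lerBrDr addrC -PhiD//.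
apply: Phi_lam; split; first exact: nfs_memD.
move=> t; apply: (le_trans (ler_normD _ _)).
have := gA t; have := hB t; have [At|At] := pselect (A t).
  rewrite (@restr_out _ _ _ _ nf B); last by move=> Bt; exact: (AB' t).
  rewrite (restr_in _ At) (restr_in _ (_ : (A `|` B) t)); last by left.
  by move=> h0 g0; rewrite -[leRHS]addr0 lerD.
rewrite (restr_out _ At); have [Bt|Bt] := pselect (B t).
  rewrite (restr_in _ Bt) (restr_in _ (_ : (A `|` B) t)); last by right.
  by move=> h0 g0; rewrite -[leRHS]add0r lerD.
rewrite (restr_out _ Bt) restr_out => [h0 g0|[]//].
by rewrite -[leRHS]addr0 lerD.
Qed.

Let lam0 : lam set0 = 0.
Proof.
have := @lamU set0 set0 measurable0 measurable0; rewrite setU0 => /(_ _)/eqP.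
rewrite -subr_eq subrr eq_sym => H; apply/eqP/H.
by move=> t [].
Qed.

Let lam_sigma : semi_sigma_additive (EFin \o lam).
Proof.
apply: continuous_at_empty_sigma_additive => // A mA ndA A0.
apply: (@squeeze_cvgr _ _ _ _ (fun=> 0) (fun n => N (restr nf (A n)))).
- apply: nearW => n /=; rewrite lam_ge0/=; apply: lam_le => g; exact: Phi_below.
- exact: cvg_cst.
- exact: f_ac.
Qed.

(** The supremum defining lambda is taken over the g below 1_A |f|. It is additive
because these g split along disjoint sets, and sigma-additive because it is at
most the norm of 1_A |f|, which tends to 0 along sequences decreasing to the
empty set. *)
Lemma control_measure : exists lambda : {finite_measure set S -> \bar R},
  (forall A, measurable A -> (lambda A <= (N (restr nf A))%:E)%E) /\
  (forall A g, measurable A -> K g -> (forall t, `|g t| <= restr nf A t) ->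
    ((Phi g)%:E <= lambda A)%E).
Proof.
have lam_ge0E A : (0 <= (EFin \o lam) A)%E by rewrite lee_fin.
have lam0E : (EFin \o lam) set0 = 0%E by rewrite /= lam0.
pose m := isMeasure.Build d S R (EFin \o lam) lam0E lam_ge0E lam_sigma.
pose lamM : {measure set S -> \bar R} := HB.pack (EFin \o lam) m.
have fin : fin_num_fun lamM by move=> A mA.
pose fm := Measure_isFinite.Build d S R lamM fin.
pose lamF : {finite_measure set S -> \bar R} := HB.pack (Measure.sort lamM) fm.
exists lamF; split => [A mA|A g mA Kg gA].
  by rewrite lee_fin; apply: lam_le => g; exact: Phi_below.
by rewrite lee_fin; exact: Phi_lam.
Qed.

End kothe_bochner_functional.

(** * Integrals over a finite measure *)
Section finite_measure_integrals.
Context d (S : measurableType d) (R : realType).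
Context (la : {finite_measure set S -> \bar R}).
Implicit Types (h : S -> R) (D : set S).

Lemma Rintegral_le0_ae_eq0 h D : measurable D -> la.-integrable D (EFin \o h) ->
  {ae la, forall t, D t -> 0 <= h t} -> \int[la]_(t in D) h t <= 0 ->
  {ae la, forall t, D t -> h t = 0}.
Proof.
move=> mD ih h0 inth; have mh := measurable_int la ih.
have E : (\int[la]_(t in D) (h t)%:E = \int[la]_(t in D) `|(EFin \o h) t|)%E.
  apply: ae_eq_integral => //; first exact: measurableT_comp.
  by apply: filterS h0 => t /[apply] ht; rewrite /= ger0_norm.
have fin : (\int[la]_(t in D) (h t)%:E)%E \is a fin_num by exact: integrable_fin_num.
have I0 : (\int[la]_(t in D) `|(EFin \o h) t|)%E = 0%E.
  apply/eqP; rewrite eq_le integral_ge0// andbT -E -(fineK fin) lee_fin.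
  exact: inth.
move/(ae_eq_integral_abs la mD mh): I0.
by apply: filterS => t /[apply] -[].
Qed.

Lemma bounded_convergence (h_ : nat -> S -> R) h c : (forall n, measurable_fun setT (h_ n)) ->
  measurable_fun setT h -> {ae la, forall t, h_ ^~ t @ \oo --> h t} ->
  {ae la, forall t, forall n, `|h_ n t| <= c} ->
  la.-integrable setT (EFin \o h) /\
  (fun n => \int[la]_t h_ n t) @ \oo --> \int[la]_t h t.
Proof.
move=> mh_ mh hh hc.
have [ih _ cvgi] : [/\ la.-integrable setT (EFin \o h),
    (fun n => \int[la]_t `|(h_ n t)%:E - (h t)%:E|)%E @ \oo --> 0%E &
    (fun n => \int[la]_t (h_ n t)%:E)%E @ \oo --> (\int[la]_t (h t)%:E)%E].
  apply: (@dominated_convergence _ _ _ la setT measurableT _ _ (EFin \o cst c)).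
  - by move=> n; exact/measurable_EFinP/mh_.
  - exact/measurable_EFinP.
  - by apply: filterS hh => t ht _; apply: cvg_EFin => //; exact: nearW.
  - exact: finite_measure_integrable_cst.
  - by apply: filterS hc => t ht n _; rewrite lee_fin.
split => //; apply: fine_cvg; rewrite fineK//; exact: integrable_fin_num.
Qed.

Lemma bounded_integrable h c : measurable_fun setT h -> {ae la, forall t, `|h t| <= c} ->
  la.-integrable setT (EFin \o h).
Proof.
move=> mh hc; apply: (@bounded_convergence (fun=> h) h c _ _ _ _).1 => //.
  by apply: aeW => t; exact: cvg_cst.
exact: filterS hc.
Qed.

(** The two implications carried by the pointwise hypothesis become one
equivalence between integrals because the mass of la is at most 1.
If h0 has integral 1, then h0 = 1 almost everywhere by h0 <= 1, so h n --> 1 and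
bounded convergence applies.
Conversely, the third condition bounding the upper limit of h n by 1,
1 - min(h n, 1) is nonnegative, and its integral converges to
la(S) - 1 <= 0. Hence la(S) = 1 and, by Markov's inequality, no set of positive
measure carries h n <= 1 - e for all large n. So 1 is a cluster value of almost
every sequence h n t, and h0 = 1 almost everywhere. *)
Lemma Rintegral_cvg1_iff (h0 : S -> R) (h : nat -> S -> R) : fine (la setT) <= 1 ->
  measurable_fun setT h0 -> (forall n, measurable_fun setT (h n)) ->
  {ae la, forall t, [/\ `|h0 t| <= 1, (forall n, `|h n t| <= 2),
    (fun n => Num.max (h n t - 1) 0) @ \oo --> (0 : R),
    (h0 t = 1 -> (fun n => h n t) @ \oo --> (1 : R)) &
    (forall e, 0 < e -> forall n, exists2 m, (n <= m)%N & 1 - e < h m t) -> h0 t = 1]} ->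
  (fun n => \int[la]_t h n t) @ \oo --> (1 : R) <-> \int[la]_t h0 t = 1.
Proof.
move=> m1 mh0 mh good.
have icst (c : R) : la.-integrable setT (EFin \o cst c) by exact: finite_measure_integrable_cst.
have ih0 : la.-integrable setT (EFin \o h0).
  by apply: (@bounded_integrable _ 1) => //; apply: filterS good => t [].
have ih n : la.-integrable setT (EFin \o h n).
  by apply: (@bounded_integrable _ 2) => //; apply: filterS good => t [].
split=> [inth|inth0]; last first.
  have h01 : {ae la, forall t, h0 t = 1}.
    have : {ae la, forall t, setT t -> 1 - h0 t = 0}.
      apply: Rintegral_le0_ae_eq0 => //.
      - have -> : EFin \o (fun t => 1 - h0 t) = ((EFin \o cst (1%R : R)) \- (EFin \o h0))%E by [].
        exact: integrableB.
      - apply: filterS good => t [ht _ _ _ _] _; rewrite subr_ge0.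
        exact: le_trans (ler_norm _) ht.
      - by rewrite (RintegralB measurableT (icst 1) ih0) Rintegral_cst// mul1r inth0 subr_le0.
    by apply: filterS => t /(_ I)/eqP; rewrite subr_eq0 => /eqP.
  have hh0 : {ae la, forall t, (fun n => h n t) @ \oo --> h0 t}.
    by apply: filterS2 good h01 => t [_ _ _ to1 _] ht; rewrite ht; exact: to1.
  have hb : {ae la, forall t, forall n, `|h n t| <= 2} by apply: filterS good => t [].
  have [_] := bounded_convergence mh mh0 hh0 hb.
  by rewrite inth0.
pose k n t := Num.max (h n t - 1) 0.
have mk n : measurable_fun setT (k n).
  by apply: measurable_maxr => //; apply: measurable_funB => //; exact: measurable_cst.
have kb : {ae la, forall t, forall n, `|k n t| <= 3}.
  apply: filterS good => t [_ ht _ _ _] n.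
  rewrite ger0_norm; last by rewrite le_max lexx orbT.
  rewrite ge_max ler0n andbT lerBlDr (le_trans (le_trans (ler_norm _) (ht n)))//.
  by rewrite natr1 ler_nat.
have k0 : {ae la, forall t, k ^~ t @ \oo --> (0 : R)} by apply: filterS good => t [].
have [_ intk] := bounded_convergence mk (@measurable_cst _ _ _ _ setT (0 : R)) k0 kb.
rewrite Rintegral_cst// mul0r in intk.
have ik n : la.-integrable setT (EFin \o k n).
  by apply: (@bounded_integrable _ 3) => //; apply: filterS kb => t.
(* This is 1 - min(h n, 1). *)
pose q n t := 1 - h n t + k n t.
have q_ge0 n t : 0 <= q n t.
  by rewrite /q /k; case: (leP (h n t - 1) 0) => H1; lra.
have iq n : la.-integrable setT (EFin \o q n).
  have -> : EFin \o q n = (((EFin \o cst (1%R : R)) \- (EFin \o h n)) \+ (EFin \o k n))%E by [].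
  by apply: integrableD => //; exact: integrableB.
have intq : (fun n => \int[la]_t q n t) @ \oo --> fine (la setT) - 1.
  have -> : (fun n => \int[la]_t q n t) =
      (fun n => fine (la setT) - \int[la]_t h n t + \int[la]_t k n t).
    apply/funext => n; rewrite (RintegralD measurableT _ (ik n)); last first.
      have -> : EFin \o (fun t => 1 - h n t) = ((EFin \o cst (1%R : R)) \- (EFin \o h n))%E by [].
      exact: integrableB.
    by rewrite (RintegralB measurableT (icst 1) (ih n)) Rintegral_cst// mul1r.
  rewrite -[X in _ --> X]addr0; apply: cvgD => //; apply: cvgB => //; exact: cvg_cst.
have m_eq1 : fine (la setT) = 1.
  apply/eqP; rewrite eq_le m1 -subr_ge0.
  apply: (cvgr_to_ge intq); apply: nearW => n; exact: Rintegral_ge0.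
rewrite m_eq1 subrr in intq.
have freq : {ae la, forall t, forall n j : nat,
    ~ (forall m, (n <= m)%N -> h m t <= 1 - j.+1%:R^-1)}.
  apply/ae_foralln => n; apply/ae_foralln => j.
  pose A := [set t | forall m, (n <= m)%N -> h m t <= 1 - j.+1%:R^-1].
  have mA : measurable A.
    rewrite (_ : A = \bigcap_(m in [set m | (n <= m)%N]) (setT `&` [set t | h m t <= 1 - j.+1%:R^-1])).
      apply: bigcap_measurable; first by exists n => /=.
      by move=> m _; apply: measurable_fun_ler => //; exact: measurable_cst.
    by apply/seteqP; split=> t At m nm; [split => //; exact: At|exact: (At m nm).2].
  exists A; split => //; last by move=> t; rewrite /= notK.
  have j0 : 0 < (j.+1%:R^-1 : R) by rewrite invr_gt0.
  have le_q : j.+1%:R^-1 * fine (la A) <= 0.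
    apply: (cvgr_to_ge intq); exists n => // m /= nm.
    rewrite -Rintegral_cst// Rintegral_mkcond; apply: le_Rintegral => //.
    + by rewrite -restrict_EFin; apply/(integrable_mkcond _ mA).1; exact: finite_measure_integrable_cst.
    + move=> t _; rewrite /patch; case: ifPn => /= [/set_mem At|_]; last exact: q_ge0.
      have := At m nm; move: (j.+1%:R^-1) j0 => e e0.
      by rewrite /q /k; case: (leP (h m t - 1) 0) => H1 H2; lra.
  apply/eqP; rewrite -fine_eq0; last exact: fin_num_measure.
  rewrite eq_le fine_ge0 ?measure_ge0// andbT.
  by rewrite -(ler_pM2l j0) mulr0.
have h01 : {ae la, forall t, h0 t = 1}.
  apply: filterS2 good freq => t [_ _ _ _ from1] fr; apply: from1 => e e0 n.
  have [j je] : exists j : nat, j.+1%:R^-1 < e.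
    by exists (Num.truncn e^-1); rewrite invf_plt ?posrE// truncnS_gt.
  have /existsNP[m /not_implyP[nm /negP]] := fr n j; rewrite -ltNge => hm.
  by exists m => //; apply: lt_trans hm; rewrite ltrD2l ltrN2.
rewrite -m_eq1 -[RHS]mul1r -Rintegral_cst//; congr fine.
apply: ae_eq_integral => //.
- exact/measurable_EFinP.
- by apply: filterS h01 => t -> _.
Qed.

End finite_measure_integrals.

(** * Densities of the functional along a vector function *)
Section density.
Context d (S : measurableType d) (R : realType).
Context (mu : {measure set S -> \bar R}) (cmu : measure_is_complete mu).
Context (E : kothe_space mu) (X : normedModType R).
Local Notation K := (kothe_bochner_space cmu E X).
Local Notation N := (nfs_norm E).
Implicit Types (f g : S -> X) (A B : set S).
Context (Phi : (S -> X) -> R).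
Hypothesis PhiD : forall f g, K f -> K g -> Phi (fun t => f t + g t) = Phi f + Phi g.
Hypothesis PhiZ : forall a f, K f -> Phi (fun t => a *: f t) = a * Phi f.
Context (f : S -> X) (la : {finite_measure set S -> \bar R}).
Let nf := fun t => `|f t|.
Hypothesis la_dom : forall A g, measurable A -> K g ->
  (forall t, `|g t| <= restr nf A t) -> ((Phi g)%:E <= la A)%E.

Local Notation m A := (fine (la A)).

Let laE A : measurable A -> la A = (m A)%:E.
Proof. by move=> mA; rewrite fineK// fin_num_measure. Qed.

Lemma functional_restr_le g A c : 0 < c -> measurable A -> K g ->
  (forall t, A t -> `|g t| <= c * `|f t|) -> Phi (restr g A) <= c * m A.
Proof.
move=> c0 mA Kg gA; have KgA := kb_restr Kg mA.
rewrite -ler_pdivrMl// -PhiZ// -lee_fin -laE//; apply: la_dom => //.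
  exact: nfs_memZ.
move=> t; rewrite normrZ gtr0_norm ?invr_gt0//; have [At|At] := pselect (A t).
  by rewrite restr_in// restr_in// ler_pdivrMl//; exact: gA.
by rewrite restr_out// restr_out// normr0 mulr0.
Qed.

Lemma functional_restr_abs_le g A c : 0 < c -> measurable A -> K g ->
  (forall t, A t -> `|g t| <= c * `|f t|) -> `|Phi (restr g A)| <= c * m A.
Proof.
move=> c0 mA Kg gA; rewrite ler_norml functional_restr_le// andbT lerNl.
rewrite -mulN1r -PhiZ; last exact: kb_restr.
rewrite -restrZ; apply: functional_restr_le => //; first exact: nfs_memZ.
by move=> t At; rewrite scaleN1r normrN; exact: gA.
Qed.

Definition density g (h : S -> R) := [/\ K g, la.-integrable setT (EFin \o h) &
  forall A, measurable A -> Phi (restr g A) = \int[la]_(t in A) h t].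

(** The set function A |-> Phi (restr g A) is dominated by c times la, so it is a
charge absolutely continuous with respect to la, and Radon-Nikodym applies. *)
Lemma density_exists g c : 0 < c -> K g -> (forall t, `|g t| <= c * `|f t|) ->
  exists h, density g h.
Proof.
move=> c0 Kg gf.
pose nu := EFin \o (fun A => Phi (restr g A)).
have nu0' : Phi (restr g set0) = 0.
  rewrite -[RHS](functional0 PhiZ); congr Phi; apply/funext => t.
  by rewrite restr_out.
have nu0 : nu set0 = 0%E by rewrite /nu/= nu0'.
have nu_fin A : measurable A -> nu A \is a fin_num by [].
have nu_sigma : semi_sigma_additive nu.
  apply: continuous_at_empty_sigma_additive => //.
    by move=> A B mA mB AB; exact: (functional_restrU PhiD Kg mA mB AB).
  move=> A mA ndA A0.
  have laA : la \o A @ \oo --> 0%E.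
    rewrite -(measure0 la).
    have <- : \bigcap_n A n = set0.
      rewrite -subset0 => t At; have [n nAt] := A0 t.
      by apply: nAt; exact: At.
    apply: nonincreasing_cvg_mu => //.
    + by rewrite ltey_eq fin_num_measure.
    + exact: bigcap_measurable.
    + by move=> n k nk; apply/subsetPset; exact: ndA.
  have mA0 : (fun n => m (A n)) @ \oo --> (0 : R) by apply: fine_cvg.
  apply: (@norm_cvg0 _ R^o).
  apply: (@squeeze_cvgr _ _ _ _ (fun=> 0) (fun n => c * m (A n))).
  - by apply: nearW => n; rewrite normr_ge0/=; exact: functional_restr_abs_le.
  - exact: cvg_cst.
  - by rewrite -(mulr0 c); exact: cvgMl_tmp.
pose nuc := isCharge.Build d S R nu nu0 nu_fin nu_sigma.
pose nuC : {charge set S -> \bar R} := HB.pack nu nuc.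
have nula : nuC `<< la.
  apply/null_content_dominatesP => A mA laA0.
  apply/eqP; rewrite eqe -normr_eq0 eq_le normr_ge0 andbT.
  apply: (le_trans (functional_restr_abs_le c0 mA Kg _)) => //.
  by rewrite laA0 mulr0.
exists (fine \o Radon_Nikodym nuC la); split => //.
  have -> : EFin \o (fine \o Radon_Nikodym nuC la) = Radon_Nikodym nuC la.
    by apply/funext => t /=; rewrite fineK//; exact: Radon_Nikodym_fin_num.
  exact: Radon_Nikodym_integrable.
move=> A mA; have := Radon_Nikodym_integral nula mA => /(congr1 fine) /= ->.
congr fine; apply: eq_integral => t _ /=.
by rewrite fineK//; exact: Radon_Nikodym_fin_num.
Qed.

Lemma density0 : density (fun=> 0) (fun=> 0).
Proof.
split; [exact: nfs_mem0|exact: integrable0|move=> A mA].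
rewrite Rintegral_cst// mul0r -[RHS](functional0 PhiZ); congr Phi.
by apply/funext => t; rewrite /restr scaler0.
Qed.

Lemma densityD g g' h h' : density g h -> density g' h' ->
  density (fun t => g t + g' t) (fun t => h t + h' t).
Proof.
move=> [Kg ih gh] [Kg' ih' gh']; split; first exact: nfs_memD.
  have -> : EFin \o (fun t => h t + h' t) = ((EFin \o h) \+ (EFin \o h'))%E by [].
  exact: integrableD.
move=> A mA; rewrite RintegralD//; [|exact: (integrableS measurableT)..].
by rewrite restrD PhiD ?gh ?gh'//; exact: kb_restr.
Qed.

Lemma densityZ a g h : density g h -> density (fun t => a *: g t) (fun t => a * h t).
Proof.
move=> [Kg ih gh]; split; first exact: nfs_memZ.
  have -> : EFin \o (fun t => a * h t) = (fun t => a%:E * (EFin \o h) t)%E by [].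
  exact: integrableZl.
move=> A mA; rewrite RintegralZl//; last exact: (integrableS measurableT).
by rewrite restrZ PhiZ ?gh//; exact: kb_restr.
Qed.

Lemma density_sum n (a : nat -> R) (g : nat -> S -> X) (h : nat -> S -> R) :
  (forall i, density (g i) (h i)) ->
  density (fun t => \sum_(i < n) a i *: g i t) (fun t => \sum_(i < n) a i * h i t).
Proof.
move=> gh; elim: n => [|n IH].
  have -> : (fun t => \sum_(i < 0) a i *: g i t) = fun=> 0.
    by apply/funext => t; rewrite big_ord0.
  have -> : (fun t => \sum_(i < 0) a i * h i t) = fun=> 0.
    by apply/funext => t; rewrite big_ord0.
  exact: density0.
have -> : (fun t => \sum_(i < n.+1) a i *: g i t) =
    fun t => (\sum_(i < n) a i *: g i t) + a n *: g n t.
  by apply/funext => t; rewrite big_ord_recr.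
have -> : (fun t => \sum_(i < n.+1) a i * h i t) =
    fun t => (\sum_(i < n) a i * h i t) + a n * h n t.
  by apply/funext => t; rewrite big_ord_recr.
by apply: densityD => //; exact: densityZ.
Qed.

(** Where h t |f t| > |g t|, some rational q separates h t from |g t| / |f t|.
On the set B q of these t the charge of density h is at most q la by domination
of g by q |f|, although h > q there; so B q is null. *)
Lemma density_le g h : K f -> density g h -> {ae la, forall t, h t * `|f t| <= `|g t|}.
Proof.
move=> Kf [Kg ih gh].
have mh : measurable_fun setT h by exact/measurable_EFinP/(measurable_int la ih).
have mg : measurable_fun setT (fun t => `|g t|) by exact: bochner_measurable_norm Kg.1.
have mf : measurable_fun setT (fun t => `|f t|) by exact: bochner_measurable_norm Kf.1.
(* For q > 0 these sets are null and cover the exceptional set. *)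
pose B (q : rat) := [set t | ratr q < h t] `&` [set t | `|g t| <= ratr q * `|f t|].
have mB q : measurable (B q).
  apply: measurableI.
    rewrite -[X in measurable X]setTI.
    by apply: measurable_fun_ltr => //; exact: measurable_cst.
  rewrite -[X in measurable X]setTI.
  apply: measurable_fun_le => //; apply: measurable_funM => //; exact: measurable_cst.
have B0 q : 0 < (ratr q : R) -> {ae la, forall t, ~ B q t}.
  move=> q0; have iB : la.-integrable (B q) (EFin \o h) by exact: (integrableS measurableT).
  have icB : la.-integrable (B q) (EFin \o cst (ratr q : R)).
    exact: finite_measure_integrable_cst.
  have H : {ae la, forall t, B q t -> h t - ratr q = 0}.
    apply: Rintegral_le0_ae_eq0 => //.
    - have -> : EFin \o (fun t => h t - ratr q) =
        ((EFin \o h) \- (EFin \o cst (ratr q : R)))%E by [].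
      exact: integrableB.
    - by apply: aeW => t [/ltW]; rewrite subr_ge0.
    - rewrite RintegralB// Rintegral_cst// subr_le0 -gh//.
      by apply: functional_restr_le => // t [].
  apply: filterS H => t + Bt => /(_ Bt)/eqP; rewrite subr_eq0 gt_eqF//.
  exact: Bt.1.
have : {ae la, forall t, forall n, ~ (exists q : rat, [/\ unpickle n = Some q, 0 < (ratr q : R) & B q t])}.
  apply/ae_foralln => n; case nq : (unpickle n) => [q|]; last first.
    by apply: aeW => t [q []].
  have [q0|q0] := pselect (0 < (ratr q : R)); last first.
    by apply: aeW => t [q' [[<-]]] /q0.
  by apply: filterS (B0 q q0) => t Bt [q' [[<-]]] _.
apply: filterS => t Bt; rewrite leNgt; apply/negP => gth.
have f0 : 0 < `|f t|.
  rewrite lt_neqAle normr_ge0 andbT eq_sym; apply/eqP => f0.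
  by move: gth; rewrite f0 mulr0 ltNge normr_ge0.
have : `|g t| / `|f t| < h t by rewrite ltr_pdivrMr.
move=> /rat_in_itvoo[q]; rewrite in_itv/= => /andP[q1 q2].
apply: (Bt (pickle q)); exists q; split; first exact: pickleK.
  by apply: le_lt_trans q1; exact: divr_ge0.
by split => //=; rewrite -ler_pdivrMr// ltW.
Qed.

End density.

(** * The argument at a point *)

Definition scons T (x : T) (u : nat -> T) (i : nat) : T := if i is n.+1 then u n else x.

Section pointwise.
Context (R : realType) (X : normedModType R).
Implicit Types (x : X) (v : nat -> X).

(** By the inequalities on rational combinations, some functional of norm at most
one maps x to a0 |x| and every v n to a n |x|, and luacs+ of X applies to it.
The last claim only assumes that 1 is a cluster value of a: luacs+ is then
applied along a subsequence. That is all an integral can detect about the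
densities. *)
Lemma luacs_plus_pointwise x v (a0 : R) (a : nat -> R) : luacs_plus X -> x != 0 ->
  (fun n => `|v n|) @ \oo --> `|x| ->
  (fun n => `|v n + x|) @ \oo --> 2 * `|x| ->
  (forall s : seq rat,
    (\sum_(i < size s) ratr s`_i * scons a0 a i) * `|x| <=
    `|\sum_(i < size s) ratr s`_i *: scons x v i|) ->
  [/\ `|a0| <= 1, (forall n, `|a n| * `|x| <= `|v n|),
      (a0 = 1 -> a @ \oo --> (1 : R)) &
      (forall e, 0 < e -> forall n, exists2 m, (n <= m)%N & 1 - e < a m) -> a0 = 1].
Proof.
move=> acsX x0 vx vxx Hs; have xn0 : 0 < `|x| by rewrite normr_gt0.
pose c i := scons a0 a i * `|x|.
have [|psi psi_le psiE] := @functional_through_points R X (scons x v) c.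
  move=> s; rewrite /c; under eq_bigr do rewrite mulrA.
  by rewrite -mulr_suml; exact: Hs.
have psix : psi x = a0 * `|x| := psiE 0.
have psiv n : psi (v n) = a n * `|x| := psiE n.+1.
have cvg_a (sg : nat -> nat) : (fun n => a (sg n)) @ \oo --> (1 : R) <->
    (fun n => psi (v (sg n)) : R) @ \oo --> `|x|.
  have -> : (fun n => psi (v (sg n)) : R) = (fun n => a (sg n) * `|x|).
    by apply/funext => n; rewrite psiv.
  split=> [H|H]; first by rewrite -[X in _ --> X]mul1r; exact: cvgMr_tmp.
  have -> : (fun n => a (sg n)) = (fun n => (a (sg n) * `|x|) * `|x|^-1).
    by apply/funext => n; rewrite mulfK// gt_eqF.
  by rewrite -(@divff _ `|x|) ?gt_eqF//; exact: cvgMr_tmp.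
have psix1 : psi x = `|x| <-> a0 = 1.
  rewrite psix; split=> [/eqP|->]; last by rewrite mul1r.
  by rewrite -subr_eq0 -[X in _ - X]mul1r -mulrBl mulf_eq0 (gt_eqF xn0) orbF subr_eq0 => /eqP.
have am n : `|a n| * `|x| <= `|v n|.
  by have := psi_le (v n); rewrite psiv normrM normr_id.
split => //.
- by rewrite -(ler_pM2r xn0) mul1r -[X in _ * X]normr_id -normrM -psix psi_le.
- move=> a01; apply/(cvg_a id); apply/(luacs_plus_cvg acsX x0 psi_le vx vxx).
  exact/psix1.
- move=> freq.
  have /choice[sg sgP] : forall n : nat, exists m, (n <= m)%N /\ 1 - n.+1%:R^-1 < a m.
    by move=> n; have [|m nm am1] := freq n.+1%:R^-1 _ n; [rewrite invr_gt0|exists m].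
  have sgoo : sg @ \oo --> \oo.
    move=> B [n _ nB]; exists n => // m /= nm; apply: nB => /=.
    exact: leq_trans nm (sgP m).1.
  have vsg : (fun n => `|v (sg n)|) @ \oo --> `|x| by exact: cvg_comp vx.
  have vxsg : (fun n => `|v (sg n) + x|) @ \oo --> 2 * `|x| by exact: cvg_comp vxx.
  apply/psix1/(luacs_plus_cvg acsX x0 psi_le vsg vxsg)/cvg_a.
  apply: (@squeeze_cvgr _ _ _ _ (fun n => 1 - n.+1%:R^-1) (fun n => `|v (sg n)| / `|x|)).
  + apply: nearW => n; rewrite (ltW (sgP n).2)/= ler_pdivlMr//.
    by apply: le_trans (am _); rewrite ler_wpM2r// ler_norm.
  + by rewrite -[X in _ --> X]subr0; apply: cvgB; [exact: cvg_cst|exact: cvg_harmonic].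
  + by rewrite -(@divff _ `|x|) ?gt_eqF//; exact: cvgMr_tmp.
Qed.

End pointwise.

(** * From the values to the integrals *)
Section core.
Context d (S : measurableType d) (R : realType).
Context (mu : {measure set S -> \bar R}) (cmu : measure_is_complete mu).
Context (E : kothe_space mu) (X : normedModType R).
Local Notation K := (kothe_bochner_space cmu E X).
Local Notation N := (nfs_norm E).
Context (Phi : (S -> X) -> R).
Hypothesis PhiD : forall f g, K f -> K g -> Phi (fun t => f t + g t) = Phi f + Phi g.
Hypothesis PhiZ : forall a f, K f -> Phi (fun t => a *: f t) = a * Phi f.
Context (f : S -> X) (Kf : K f) (la : {finite_measure set S -> \bar R}).
Let nf := fun t => `|f t|.
Hypothesis norm_f : nfs_norm K f = 1.
Hypothesis la_dom : forall A g, measurable A -> K g ->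
  (forall t, `|g t| <= restr nf A t) -> ((Phi g)%:E <= la A)%E.
Hypothesis la_le : forall A, measurable A -> (la A <= (N (restr nf A))%:E)%E.
Context (g : nat -> S -> X) (Kg : forall n, K (g n)).
Hypothesis g_le : forall n t, `|g n t| <= 2 * `|f t|.
Hypothesis g_norm : {ae la, forall t, (fun n => `|g n t|) @ \oo --> `|f t|}.
Hypothesis g_norm2 : {ae la, forall t, (fun n => `|g n t + f t|) @ \oo --> 2 * `|f t|}.

(** The control measure is bounded by the norm of the restriction of |f|, which
vanishes on the zero set of f. *)
Lemma control_measure_neq0 : {ae la, forall t, f t != 0}.
Proof.
have mA : measurable [set t | f t = 0].
  rewrite (_ : [set _ | _] = setT `&` nf @^-1` [set 0]).
    by apply: (bochner_measurable_norm cmu Kf.1) => //; exact: measurable_set1.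
  rewrite setTI; apply/seteqP; split=> t; rewrite /nf/=; last exact: normr0_eq0.
  by move=> ->; rewrite normr0.
exists [set t | f t = 0]; split => //.
- apply/eqP; rewrite eq_le measure_ge0 andbT.
  apply: (le_trans (la_le mA)); rewrite (_ : restr nf _ = fun=> 0).
    by rewrite (_ : N (fun=> 0) = 0)//; apply/(nfs_norm_eq0 (nfs_mem0 E))/aeW.
  apply/funext => t; have [ft|ft] := pselect (f t = 0); last by rewrite restr_out.
  by rewrite restr_in// /nf ft normr0.
- by move=> t /= /negP; rewrite negbK => /eqP.
Qed.


(** The pointwise lemma is applied to the densities of f and of the g n, outside one
null set chosen for all rational combinations. *)
Lemma luacs_plus_functional : luacs_plus X ->
  (Phi \o g) @ \oo --> (1 : R) <-> Phi f = 1.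
Proof.
move=> acsX.
have [h0 dh0] : exists h, density cmu E Phi la f h.
  by apply: (@density_exists _ _ _ _ _ _ _ _ PhiD PhiZ f la la_dom f 1) => // t; rewrite mul1r.
have /choice[h dh] : forall n, exists h, density cmu E Phi la (g n) h.
  by move=> n; exact: (@density_exists _ _ _ _ _ _ _ _ PhiD PhiZ f la la_dom (g n) 2).
pose w i t := scons (f t) (g^~ t) i.
pose H i t := scons (h0 t) (h^~ t) i.
have dw i : density cmu E Phi la (w i) (H i) by case: i.
(* Sequences of rationals are countably many, so one null set serves for all. *)
have combos : {ae la, forall t, forall s : seq rat,
    (\sum_(i < size s) ratr s`_i * H i t) * `|f t| <= `|\sum_(i < size s) ratr s`_i *: w i t|}.
  have : {ae la, forall t, forall n, forall s : seq rat, unpickle n = Some s ->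
    (\sum_(i < size s) ratr s`_i * H i t) * `|f t| <= `|\sum_(i < size s) ratr s`_i *: w i t|}.
    apply/ae_foralln => n; case ns : (unpickle n) => [s|]; last by apply: aeW => t s.
    have := density_le PhiZ la_dom Kf (density_sum PhiD PhiZ (size s) (fun i => ratr s`_i) dw).
    by apply: filterS => t Ht s' [<-].
  by apply: filterS => t Ht s; apply: (Ht (pickle s)); exact: pickleK.
have mh n : measurable_fun setT (h n).
  by have [_ ih _] := dh n; exact/measurable_EFinP/(measurable_int la ih).
have mh0 : measurable_fun setT h0.
  by have [_ ih _] := dh0; exact/measurable_EFinP/(measurable_int la ih).
have good : {ae la, forall t, [/\ `|h0 t| <= 1, (forall n, `|h n t| <= 2),
    (fun n => Num.max (h n t - 1) 0) @ \oo --> (0 : R),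
    (h0 t = 1 -> (fun n => h n t) @ \oo --> (1 : R)) &
    (forall e, 0 < e -> forall n, exists2 m, (n <= m)%N & 1 - e < h m t) -> h0 t = 1]}.
  near=> t.
  have ft0 : f t != 0 by near: t; exact: control_measure_neq0.
  have gt1 : (fun n => `|g n t|) @ \oo --> `|f t| by near: t.
  have gt2 : (fun n => `|g n t + f t|) @ \oo --> 2 * `|f t| by near: t.
  have Hs : forall s : seq rat,
    (\sum_(i < size s) ratr s`_i * H i t) * `|f t| <= `|\sum_(i < size s) ratr s`_i *: w i t|.
    by near: t.
  have ftn0 : 0 < `|f t| by rewrite normr_gt0.
  have [|h01 hn to1 from1] := @luacs_plus_pointwise R X (f t) (g^~ t) (h0 t) (h^~ t) acsX ft0 gt1 gt2.
    exact: Hs.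
  split => //.
    by move=> n; rewrite -(ler_pM2r ftn0); exact: le_trans (hn n) (g_le n t).
  apply: (@squeeze_cvgr _ _ _ _ (fun=> 0) (fun n => `| `|g n t| / `|f t| - 1|)).
  - apply: nearW => n; rewrite le_max lexx orbT/= ge_max normr_ge0 andbT.
    apply: le_trans (ler_norm _); rewrite lerB// ler_pdivlMr//.
    by apply: le_trans (hn n); rewrite ler_wpM2r// ler_norm.
  - exact: cvg_cst.
  - have -> : (0 : R) = `|1 - 1| by rewrite subrr normr0.
    apply: cvg_norm; apply: cvgB; last exact: cvg_cst.
    by rewrite -[X in _ --> X](@divff _ `|f t|) ?gt_eqF//; exact: cvgMr_tmp.
have intE k u : density cmu E Phi la u k -> Phi u = \int[la]_t k t.
  by move=> [_ _ <-//]; congr Phi; apply/funext => t; rewrite restr_in.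
have int_h n : Phi (g n) = \int[la]_t h n t by exact: intE.
have int_h0 : Phi f = \int[la]_t h0 t by exact: intE.
have m1 : fine (la setT) <= 1.
  rewrite -lee_fin fineK ?fin_num_measure//; apply: (le_trans (la_le measurableT)).
  rewrite lee_fin -norm_f le_eqVlt; apply/orP; left; apply/eqP.
  by congr (N _); apply/funext => t; rewrite restr_in.
have -> : Phi \o g = (fun n => \int[la]_t h n t) by apply/funext => n; exact: int_h.
by rewrite int_h0; exact: Rintegral_cvg1_iff.
Unshelve. all: by end_near. Qed.
End core.

(** * Reduction to pointwise convergence *)

(** Continuity is what makes the supremum defining the dual norm a genuine upper
bound. *)
Lemma dual_sphere_le (R : realType) (V : normedModType R) (phi : {linear V -> R^o}) :
  dual_sphere phi -> forall x, `|phi x| <= `|x|.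
Proof.
move=> [cphi phi1] x; have [->|x0] := eqVneq x 0; first by rewrite linear0 !normr0.
have xn0 : 0 < `|x| by rewrite normr_gt0.
have /linear_boundedP/pinfty_ex_gt0[r r0 rP] : bounded_near phi (nbhs (0 : V)).
  by apply: continuous_linear_bounded; exact: cphi.
have : `|phi (`|x|^-1 *: x)| <= 1.
  rewrite -phi1; apply: ub_le_sup.
    exists r => _ [y /= y1 <-]; apply: (le_trans (rP y)).
    by rewrite ler_piMr// ltW.
  by exists (`|x|^-1 *: x) => //=; rewrite normrZ normfV normr_id mulVf// gt_eqF.
by rewrite linearZ normrZ normfV normr_id ler_pdivrMl// mulr1.
Qed.

Section kothe_bochner_LUR.
Context d (S : measurableType d) (R : realType).
Context (mu : {measure set S -> \bar R}) (cmu : measure_is_complete mu).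
Context (E : kothe_space mu) (X : normedModType R).
Local Notation K := (kothe_bochner_space cmu E X).
Local Notation N := (nfs_norm E).

(** It measures how far g t and f t are from the premise of luacs+ in X, in
unnormalized form. *)
Definition norm_defect (f g : S -> X) (t : S) : R :=
  `| `|g t| - `|f t| | + `| `|g t + f t| - 2 * `|f t| |.

Lemma norm_defect_kothe f g : K f -> K g -> E (norm_defect f g) /\
  N (norm_defect f g) <= N (fun t => `|g t| - `|f t|) +
    2 * N (fun t => 2^-1 *: `|g t + f t| - `|f t|).
Proof.
move=> Kf Kg; have KD : K (fun t => g t + f t) by exact: nfs_memD.
have E1 : E (fun t => `|g t| - `|f t|) by apply: nfs_memB; [exact: Kg.2|exact: Kf.2].
have E2 : E (fun t => 2^-1 *: `|g t + f t| - `|f t|).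
  by apply: nfs_memB; [apply: nfs_memZ; exact: KD.2|exact: Kf.2].
have [A1 <-] := kothe_abs E1.
have [A2 N2] := kothe_abs (nfs_memZ 2 E2).
have <- : N (fun t => `|2 *: (2^-1 *: `|g t + f t| - `|f t|)|) =
  2 * N (fun t => 2^-1 *: `|g t + f t| - `|f t|).
  by rewrite N2 nfs_normZ// ger0_norm.
have -> : norm_defect f g = fun t => `| `|g t| - `|f t| | +
    `|2 *: (2^-1 *: `|g t + f t| - `|f t|)|.
  apply/funext => t; rewrite /norm_defect scalerBr scalerA divff ?scale1r//.
by split; [exact: nfs_memD|exact: nfs_normD].
Qed.

(** Rotundity of E at |f(.)| is applied to |u n(.)|, then to p n = |u n(.) + f(.)| / 2.
In the second case 2 p n <= p n + |f(.)| + | |u n(.)| - |f(.)| | / 2, so the norm of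
p n + |f(.)| is asymptotically at least 2 |p n|, which tends to 2. *)
Lemma LUR_norm_defect f (u : nat -> S -> X) : LUR (ae_class E) -> K f -> (forall n, K (u n)) ->
  nfs_norm K f = 1 -> (forall n, nfs_norm K (u n) = 1) ->
  (fun n => nfs_norm K (fun t => u n t + f t)) @ \oo --> (2 : R) ->
  (fun n => N (norm_defect f (u n))) @ \oo --> (0 : R).
Proof.
move=> lurE Kf Ku f1 u1 uf.
pose nf t := `|f t|; pose nu n t := `|u n t|.
have Enf : E nf by exact: Kf.2.
have Enu n : E (nu n) by exact: (Ku n).2.
have Nnf : N nf = 1 by exact: f1.
have Nnu n : N (nu n) = 1 by exact: u1.
pose p n t : R := 2^-1 *: `|u n t + f t|.
have KD n : K (fun t => u n t + f t) by exact: nfs_memD.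
have Ep n : E (p n) by apply: nfs_memZ; exact: (KD n).2.
have Np n : N (p n) = 2^-1 * nfs_norm K (fun t => u n t + f t).
  by rewrite /p nfs_normZ ?ger0_norm ?invr_ge0//; exact: (KD n).2.
have c1 : (fun n => N (fun t => nu n t - nf t)) @ \oo --> (0 : R).
  apply: LUR_nfs_cvg => //.
    by rewrite Nnf; under eq_fun do rewrite Nnu; exact: cvg_cst.
  rewrite Nnf mulr1.
  apply: (@squeeze_cvgr _ _ _ _ (fun n => nfs_norm K (fun t => u n t + f t)) (fun=> 2)) => //.
    apply: nearW => n; apply/andP; split; last first.
      by apply: (le_trans (nfs_normD (Enu n) Enf)); rewrite Nnu Nnf; lra.
    have ED : E (fun t => nu n t + nf t) by exact: nfs_memD.
    have [|//] := @kb_dominated _ _ _ _ cmu E X _ _ ED (KD n).1; move=> t.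
    by rewrite [leRHS]ger0_norm ?addr_ge0 ?normr_ge0// ler_normD.
  exact: cvg_cst.
have c2 : (fun n => N (fun t => p n t - nf t)) @ \oo --> (0 : R).
  have cp : (fun n => N (p n)) @ \oo --> (1 : R).
    under eq_fun do rewrite Np.
    have := @cvgMl_tmp _ _ _ _ _ (2^-1 : R) _ uf.
    by rewrite mulVf//; apply.
  apply: LUR_nfs_cvg => //; rewrite Nnf// mulr1.
  apply: (@squeeze_cvgr _ _ _ _
    (fun n => 2 * N (p n) - 2^-1 * N (fun t => nu n t - nf t)) (fun n => N (p n) + 1)).
  - apply: nearW => n; apply/andP; split; last first.
      by rewrite -Nnf; exact: nfs_normD.
    have Ed : E (fun t => nu n t - nf t) by exact: nfs_memB.
    have [Ea <-] := kothe_abs Ed.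
    rewrite lerBlDr.
    have -> : 2 * N (p n) = N (fun t => 2 *: p n t) by rewrite (nfs_normZ 2 (Ep n)) ger0_norm.
    have -> : 2^-1 * N (fun t => `|nu n t - nf t|) = N (fun t => 2^-1 *: `|nu n t - nf t|).
      by rewrite (nfs_normZ 2^-1 Ea) ger0_norm// invr_ge0.
    have Epf : E (fun t => p n t + nf t) by exact: nfs_memD.
    have Eaz : E (fun t => (2^-1 : R) *: `|nu n t - nf t|) by exact: nfs_memZ.
    apply: le_trans (nfs_normD Epf Eaz).
    apply: (kothe_le (nfs_memD Epf Eaz) _ _).2; first exact/ks_measurable/nfs_memZ.
    move=> t; rewrite /p /nf /nu /GRing.scale /=.
    have H1 := ler_normD (u n t) (f t).
    have H2 := ler_norm (`|u n t| - `|f t|).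
    have H3 := normr_ge0 (u n t + f t).
    have H4 := normr_ge0 (f t).
    have H5 := normr_ge0 (`|u n t| - `|f t|).
    rewrite [leLHS]ger0_norm; last lra.
    rewrite [leRHS]ger0_norm; last lra.
    lra.
  - have := cvgB (@cvgMl_tmp _ _ _ _ _ 2 _ cp) (@cvgMl_tmp _ _ _ _ _ 2^-1 _ c1).
    by rewrite mulr1 mulr0 subr0; apply.
  - have := cvgD cp (cvg_cst (1 : R)); rewrite (_ : 1 + 1 = 2 :> R)//; apply.
apply: (@squeeze_cvgr _ _ _ _ (fun=> 0) (fun n => N (fun t => nu n t - nf t) +
  2 * N (fun t => p n t - nf t))).
- apply: nearW => n; have [En le_n] := norm_defect_kothe Kf (Ku n).
  by rewrite le_n andbT nfs_norm_ge0.
- exact: cvg_cst.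
- rewrite -[X in _ --> X]addr0 -[X in _ --> _ + X](mulr0 2).
  by apply: cvgD => //; exact: cvgMl_tmp.
Qed.


(** Since la is bounded by the norm of the restriction of w, the set where
h m >= w / (n + 1) has measure at most n + 1 times the norm of h m. Choosing m = sg n
with norm at most 2^-(n+1) / (n + 1) makes these measures summable, and the
Borel-Cantelli lemma concludes. *)
Lemma kothe_cvg0_subseq_ae (la : {measure set S -> \bar R}) (w : S -> R) (h : nat -> S -> R) :
  E w -> (forall t, 0 <= w t) ->
  (forall A, measurable A -> (la A <= (N (restr w A))%:E)%E) ->
  (forall n, E (h n)) -> (forall n t, 0 <= h n t) ->
  (fun n => N (h n)) @ \oo --> (0 : R) ->
  exists2 sg : nat -> nat, (forall n, n <= sg n)%N &
    {ae la, forall t, exists n0, forall n, (n0 <= n)%N -> h (sg n) t < n.+1%:R^-1 * w t}.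
Proof.
move=> Ew w_ge0 la_le Eh h_ge0 Nh0.
have /choice[sg sgP] : forall n : nat, exists m, (n <= m)%N /\
    N (h m) <= n.+1%:R^-1 * 2^-1 ^+ n.+1.
  move=> n; have e0 : 0 < (n.+1%:R^-1 * 2^-1 ^+ n.+1 : R).
    by rewrite mulr_gt0// ?exprn_gt0// invr_gt0.
  have /cvgrPdist_lt/(_ _ e0)[m _ mP] := Nh0.
  exists (maxn n m); split; first exact: leq_maxl.
  have := mP (maxn n m) (leq_maxr _ _); rewrite sub0r normrN => /ltW.
  by apply: le_trans; exact: ler_norm.
exists sg => [n|]; first by have [] := sgP n.
pose B n := [set t | n.+1%:R^-1 * w t <= h (sg n) t].
have mB n : measurable (B n).
  rewrite -[B n]setTI; apply: measurable_fun_ler => //; last exact: ks_measurable (Eh _).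
  by apply: measurable_funM; [exact: measurable_cst|exact: ks_measurable Ew].
have laB n : (la (B n) <= (2^-1 ^+ n.+1)%:E)%E.
  apply: (le_trans (la_le _ (mB n))); rewrite lee_fin.
  have n0 : 0 < (n.+1%:R^-1 : R) by rewrite invr_gt0.
  rewrite -(ler_pM2l n0); apply: le_trans (sgP n).2.
  have EB := (kothe_restr Ew (mB n)).1.
  have -> : n.+1%:R^-1 * N (restr w (B n)) = N (fun t => n.+1%:R^-1 *: restr w (B n) t).
    by rewrite nfs_normZ// gtr0_norm.
  apply: (kothe_le (Eh _) _ _).2; first exact: ks_measurable (nfs_memZ _ EB).
  move=> t; rewrite [leRHS]ger0_norm//; have [Bt|Bt] := pselect (B n t); last first.
    by rewrite restr_out// scaler0 normr0.
  by rewrite restr_in// ger0_norm// mulr_ge0// ltW.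
exists (lim_sup_set B); split.
- apply: bigcap_measurable; first by exists 0%N.
  by move=> k _; apply: bigcup_measurable => j _; exact: mB.
- apply: lim_sup_set_cvg0 => //.
  apply: (@le_lt_trans _ _ (\sum_(n <oo) (1 / (2 ^ (n + 1))%:R)%:E)%E).
    apply: lee_nneseries => // n _; apply: (le_trans (laB n)).
    by rewrite div1r natrX exprVn addn1.
  have /cvg_lim -> // := @cvg_geometric_eseries_half R 1 0.
  by rewrite ltry.
- move=> t nt n _; apply: contrapT => nB; apply: nt; exists n => m nm.
  by rewrite ltNge; apply/negP => hm; apply: nB; exists m.
Qed.

Section functional.
Context (Phi : (S -> X) -> R).
Hypothesis PhiD : forall f g, K f -> K g -> Phi (fun t => f t + g t) = Phi f + Phi g.
Hypothesis PhiZ : forall a f, K f -> Phi (fun t => a *: f t) = a * Phi f.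
Hypothesis Phi_le : forall f, K f -> Phi f <= nfs_norm K f.

Lemma functional_dist_le f g : K f -> K g ->
  `|Phi f - Phi g| <= nfs_norm K (fun t => f t - g t).
Proof.
move=> Kf Kg; have PhiB h k : K h -> K k -> Phi h - Phi k = Phi (fun t => h t - k t).
  move=> Kh Kk; rewrite -mulN1r -PhiZ// -PhiD//; last exact: nfs_memZ.
  by congr Phi; apply/funext => t; rewrite scaleN1r.
have Ksub := nfs_memB Kf Kg.
rewrite ler_norml PhiB// Phi_le// andbT lerNl -mulN1r -PhiZ//.
apply: (le_trans (Phi_le (nfs_memZ _ Ksub))).
by rewrite nfs_normZ// normrN1 mul1r.
Qed.

(** The truncation g n of u (sg n) to the set where its norm is at most 2 |f| agrees
with u (sg n) almost everywhere for large n, and differs from it in E(X) by at most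
twice the norm defect, since |u| <= 2 (|u| - |f|) where |u| > 2 |f|. *)
Lemma luacs_plus_functional_subseq f (u : nat -> S -> X) :
  LUR (ae_class E) -> luacs_plus X -> K f -> (forall n, K (u n)) -> nfs_norm K f = 1 ->
  (fun n => N (norm_defect f (u n))) @ \oo --> (0 : R) ->
  exists2 sg : nat -> nat, (forall n, n <= sg n)%N &
    (fun n => Phi (u (sg n))) @ \oo --> (1 : R) <-> Phi f = 1.
Proof.
move=> lurE acsX Kf Ku f1 hu.
pose nf t := `|f t|.
have Enf : E nf by exact: Kf.2.
have f_ac : continuous_at_empty (fun A => N (restr nf A)).
  by move=> A mA ndA A0; exact: (LUR_absolutely_continuous lurE Enf).
have [la [la_le la_dom]] := control_measure PhiD PhiZ Phi_le Kf f_ac.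
have Eh n : E (norm_defect f (u n)) := (norm_defect_kothe Kf (Ku n)).1.
have h_ge0 n t : 0 <= norm_defect f (u n) t by rewrite addr_ge0.
have [sg sgn small] := kothe_cvg0_subseq_ae Enf (fun t => normr_ge0 (f t)) la_le Eh h_ge0 hu.
exists sg => //.
pose v n := u (sg n); pose h n := norm_defect f (v n).
have Kv n : K (v n) by exact: Ku.
have mf : measurable_fun setT nf by exact: ks_measurable Enf.
pose T n := [set t | `|v n t| <= 2 * nf t].
have mT n : measurable (T n).
  rewrite -[T n]setTI; apply: measurable_fun_ler => //.
    exact: (bochner_measurable_norm cmu (Kv n).1).
  by apply: measurable_funM => //; exact: measurable_cst.
pose g n := restr (v n) (T n).
have Kg n : K (g n) by exact: kb_restr.
have g_le n t : `|g n t| <= 2 * `|f t|.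
  rewrite /g; have [Tt|Tt] := pselect (T n t); first by rewrite restr_in.
  by rewrite restr_out// normr0 mulr_ge0.
have g_eq : {ae la, forall t, exists n0, forall n, (n0 <= n)%N ->
    g n t = v n t /\ h n t < n.+1%:R^-1 * nf t}.
  apply: filterS small => t [n0 n0P]; exists n0 => n n0n.
  split; last exact: n0P.
  rewrite /g restr_in// /T/=.
  have H1 := ltW (n0P n n0n).
  have H2 : n.+1%:R^-1 * nf t <= nf t.
    by rewrite ler_piMl ?normr_ge0// invf_le1// ler1n.
  have := le_trans H1 H2; rewrite /h /norm_defect /nf.
  have := normr_ge0 (`|v n t + f t| - 2 * `|f t|).
  have := ler_norm (`|v n t| - `|f t|).
  clear; lra.
have harm (r : R) : (fun n : nat => n.+1%:R^-1 * r) @ \oo --> (0 : R).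
  by rewrite -(mul0r r); apply: cvgMr_tmp; exact: cvg_harmonic.
have g_norm : {ae la, forall t, (fun n => `|g n t|) @ \oo --> `|f t|}.
  apply: filterS g_eq => t [n0 n0P]; apply/subr_cvg0; apply: norm_cvg0.
  apply: (@squeeze_cvgr _ _ _ _ (fun=> 0) (fun n => n.+1%:R^-1 * nf t)) => //; last exact: cvg_cst.
  exists n0 => // n /= /n0P[-> /ltW hn]; rewrite normr_ge0/=.
  by apply: le_trans hn; rewrite /h/norm_defect lerDl.
have g_norm2 : {ae la, forall t, (fun n => `|g n t + f t|) @ \oo --> 2 * `|f t|}.
  apply: filterS g_eq => t [n0 n0P]; apply/subr_cvg0; apply: norm_cvg0.
  apply: (@squeeze_cvgr _ _ _ _ (fun=> 0) (fun n => n.+1%:R^-1 * nf t)) => //; last exact: cvg_cst.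
  exists n0 => // n /= /n0P[-> /ltW hn]; rewrite normr_ge0/=.
  by apply: le_trans hn; rewrite /h/norm_defect lerDr.
have core := luacs_plus_functional PhiD PhiZ Kf f1 la_dom la_le Kg g_le g_norm g_norm2 acsX.
have Nh0 : (fun n => N (h n)) @ \oo --> (0 : R).
  apply: (cvg_comp _ _ _ hu) => B' [n _ nB]; exists n => // m /= nm; apply: nB => /=.
  exact: leq_trans nm (sgn m).
have dist0 : (fun n => Phi (v n) - Phi (g n)) @ \oo --> (0 : R).
  apply: norm_cvg0.
  apply: (@squeeze_cvgr _ _ _ _ (fun=> 0) (fun n => 2 * N (h n))).
  - apply: nearW => n; rewrite normr_ge0/=.
    apply: (le_trans (functional_dist_le (Kv n) (Kg n))).
    have -> : 2 * N (h n) = N (fun t => 2 *: h n t).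
      by rewrite nfs_normZ ?ger0_norm//; exact: Eh.
    have [|//] := @kb_dominated _ _ _ _ cmu E X _ _ (nfs_memZ 2 (Eh (sg n))) (nfs_memB (Kv n) (Kg n)).1.
    move=> t; rewrite [leRHS]ger0_norm; last by rewrite mulr_ge0// h_ge0.
    rewrite /g; have [Tt|Tt] := pselect (T n t).
      by rewrite restr_in// subrr normr0 mulr_ge0// h_ge0.
    rewrite restr_out// subr0; move/negP: Tt; rewrite -ltNge /nf.
    have := normr_ge0 (`|v n t + f t| - 2 * `|f t|).
    have := ler_norm (`|v n t| - `|f t|).
    by rewrite /h /norm_defect /GRing.scale/=; lra.
  - exact: cvg_cst.
  - by have := @cvgMl_tmp _ _ _ _ _ (2 : R) _ Nh0; rewrite mulr0; apply.
rewrite -core; split=> H.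
  have -> : Phi \o g = (fun n => Phi (v n) - (Phi (v n) - Phi (g n))).
    by apply/funext => n /=; rewrite opprB addrC subrK.
  by have := cvgB H dist0; rewrite subr0; apply.
have -> : (fun n => Phi (u (sg n))) = (fun n => Phi (g n) + (Phi (v n) - Phi (g n))).
  by apply/funext => n /=; rewrite addrC subrK.
by have := cvgD H dist0; rewrite addr0; apply.
Qed.

End functional.
End kothe_bochner_LUR.

Section main.
Context d (S : measurableType d) (R : realType).
Context (mu : {measure set S -> \bar R}) (cmu : measure_is_complete mu).
Context (E : kothe_space mu) (X : normedModType R).
Local Notation K := (kothe_bochner_space cmu E X).

(** The functional is moved to representatives. If phi (u n) does not converge to 1
although phi x = 1, a subsequence stays away from 1, and the previous lemma applied
to this subsequence gives a contradiction. *)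
Lemma LUR_luacs_plus_kothe_bochner : LUR (ae_class E) -> luacs_plus X ->
  luacs_plus (ae_class K).
Proof.
move=> lurE acsX x u x1 u1 ux phi dphi.
have phi_le := dual_sphere_le dphi.
pose Phi (g : S -> X) : R := if pselect (K g) is left Kg then phi (ae_class_of Kg) else 0.
have PhiE g (Kg : K g) : Phi g = phi (ae_class_of Kg).
  by rewrite /Phi; case: pselect => // Kg'; rewrite (Prop_irrelevance Kg' Kg).
have PhiD g h : K g -> K h -> Phi (fun t => g t + h t) = Phi g + Phi h.
  move=> Kg Kh; rewrite (PhiE g Kg) (PhiE h Kh) (PhiE _ (nfs_memD Kg Kh)).
  by rewrite -ae_class_ofD linearD.
have PhiZ a g : K g -> Phi (fun t => a *: g t) = a * Phi g.
  by move=> Kg; rewrite (PhiE g Kg) (PhiE _ (nfs_memZ a Kg)) -ae_class_ofZ linearZ.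
have Phi_le g : K g -> Phi g <= nfs_norm K g.
  move=> Kg; rewrite (PhiE g Kg) -(ae_class_of_norm Kg).
  exact: le_trans (ler_norm _) (phi_le _).
have Phi_repr y : Phi (ae_repr y) = phi y by rewrite (PhiE _ (ae_reprP y)) ae_reprK.
pose f := ae_repr x; pose v n := ae_repr (u n).
have Kf : K f := ae_reprP x.
have Kv n : K (v n) := ae_reprP (u n).
have vf : (fun n => nfs_norm K (fun t => v n t + f t)) @ \oo --> (2 : R).
  have -> : (fun n => nfs_norm K (fun t => v n t + f t)) = (fun n => `|u n + x|).
    by apply/funext => n; rewrite -(ae_class_of_normD (Kv n) Kf) !ae_class_of_repr.
  exact: ux.
have defect := LUR_norm_defect lurE Kf Kv x1 u1 vf.
have phiE (sg : nat -> nat) : (fun n => phi (u (sg n)) : R) = (fun n => Phi (v (sg n))).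
  by apply/funext => n; rewrite Phi_repr.
rewrite -Phi_repr; split=> [phiu|Phif].
  have [sg sgn [toPhi _]] := luacs_plus_functional_subseq PhiD PhiZ Phi_le lurE acsX Kf Kv x1 defect.
  apply: toPhi; rewrite -phiE; apply: (cvg_comp sg _ _ phiu) => B [n _ nB].
  exists n => // m /= nm; apply: nB => /=; exact: leq_trans nm (sgn m).
apply: contrapT => nphi.
have [e e0 eP] : exists2 e : R, 0 < e & forall n, exists m, (n <= m)%N /\ e <= `|1 - phi (u m)|.
  apply: contrapT => ne; apply: nphi; apply/cvgrPdist_lt => e e0.
  apply: contrapT => nn; apply: ne; exists e => // n; apply: contrapT => nm.
  apply: nn; exists n => // m /= nm'; rewrite ltNge; apply/negP => em.
  by apply: nm; exists m.
have /choice[rho rhoP] := eP.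
have defect' : (fun n => nfs_norm E (norm_defect f (v (rho n)))) @ \oo --> (0 : R).
  apply: (cvg_comp rho _ _ defect) => B [n _ nB].
  exists n => // m /= nm; apply: nB => /=; exact: leq_trans nm (rhoP m).1.
have [sg sgn [_ /(_ Phif)]] := luacs_plus_functional_subseq PhiD PhiZ Phi_le lurE acsX Kf
  (fun n => Kv (rho n)) x1 defect'.
rewrite -(phiE (rho \o sg)) => /cvgrPdist_lt /(_ e e0)[n _ /(_ n (leqnn n))] /=.
by rewrite ltNge (rhoP (sg n)).2.
Qed.

End main.

Theorem theorem3p5 (R : realType) (d : measure_display) (S : measurableType d)
  (mu : {measure set S -> \bar R}) (cmu : measure_is_complete mu)
  (E : kothe_space mu) (X : completeNormedModType R) :
  ((mu [set: S] < +oo)%E ->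
   LUR (ae_class E) ->
   luacs_plus X ->
   luacs_plus (ae_class (kothe_bochner_space cmu E X)))
  /\
  (sigma_finite [set: S] mu ->
   LUR (ae_class E) ->
   order_continuous mu (kothe_dual E) (kothe_dual_norm E) ->
   luacs_plus X ->
   luacs_plus (ae_class (kothe_bochner_space cmu E X))).
Proof.
split=> [_ lurE|_ lurE _]; exact: LUR_luacs_plus_kothe_bochner.
Qed.
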